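(* Any language $L$ that is linear-space reducible to $L_{KG}$ is verified by a 2ADfA with bounded error $\epsilon$, moreover, the protocol achieves perfect completeness.
   Context: The Knapsack-game language is $L_{KG}=\{ S\, \forall(a_1,b_1)\, \exists(e_1,f_1)\, \cdots \, \forall(a_n,b_n)\, \exists(e_n,f_n) \}$, where $S$ and each $a_i,b_i,e_i,f_i$ are natural numbers given in binary, and for every $x\in \prod_{i=1}^{n}\{a_i,b_i\}$ there exists $y\in \prod_{i=1}^{n}\{e_i,f_i\}$ with $S=\sum_{i=1}^{n}(x_i+y_i)$. An affine state of an $m$-state affine register is a vector $v\in\mathbb{R}^m$ whose entries sum to $1$; affine operators are real matrices whose columns each sum to $1$; weighting observes basis state $e_j$ with probability $|v_j|/\|v\|_1$. A 2ADfA is a two-way deterministic finite automaton on the read-only input $¢ w\$$ (left end-marker ¢, right end-marker \$) equipped with finitely many affine registers (with rational transition matrices), each updated by an affine operator or weighted at each step, with the deterministic state and head move then depending on state, symbol and weighting outcomes; it halts upon entering an accepting or rejecting state. The 2ADfA is the verifier in an Arthur–Merlin proof system (public coins: deterministic states, head moves and weighting outcomes are revealed to the all-powerful prover). Verification with error $\epsilon<1/2$ (rational): some prover makes every $w\in L$ accepted with probability at least $1-\epsilon$, and for every $w\notin L$ and every prover, $w$ is rejected with probability at least $1-\epsilon$. Perfect completeness means every $w\in L$ is accepted with probability $1$. *)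

(* Defs.v *)
(* All probabilities are rational (rational matrices and
   initial vectors), so everything is computed in [rat]. *)
From HB Require Import structures.
From mathcomp Require Import all_boot all_order all_algebra.
Unset Printing Implicit Defensive.
Import Order.TTheory GRing.Theory Num.Theory.

(* Read-only input tape  ¢ w $ : position 0 is ¢, positions 1..|w| hold w,
   position |w|+1 is $.                                                 *)
Inductive tsym (S : Type) := LEnd | REnd | Sym of S.
Arguments LEnd {S}. Arguments REnd {S}. Arguments Sym {S}.

Definition tape_at {S : Type} (w : seq S) (i : nat) : tsym S :=
  match i with
  | 0 => LEnd
  | i'.+1 => match drop i' w with x :: _ => Sym x | [::] => REnd end
  end.

Inductive move := MLeft | MStay | MRight.

(* head move on the input tape ¢w$ (positions 0 .. bound); the head never
   leaves the end-markers *)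
Definition move_in (bound : nat) (m : move) (p : nat) : nat :=
  match m with MLeft => p.-1 | MStay => p | MRight => minn p.+1 bound end.

Definition move_work (m : move) (p : nat) : nat :=
  match m with MLeft => p.-1 | MStay => p | MRight => p.+1 end.

Inductive kgsym := K0 | K1 | KAll | KEx | KLp | KRp | KComma.

Definition bits (s : seq bool) : seq kgsym := map (fun b : bool => if b then K1 else K0) s.
(* most significant bit first *)
Definition bitval (s : seq bool) : nat := foldl (fun a (b : bool) => (a.*2 + b)%N) 0%N s.

Definition enc_block (blk : seq bool * seq bool * seq bool * seq bool) : seq kgsym :=
  let: (a, b, e, f) := blk in
  KAll :: KLp :: bits a ++ KComma :: bits b ++ KRp ::
  KEx :: KLp :: bits e ++ KComma :: bits f ++ [:: KRp].

Definition enc_KG (S : seq bool) (blks : seq (seq bool * seq bool * seq bool * seq bool)) :=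
  bits S ++ flatten (map enc_block blks).

(* for every x in prod {a_i,b_i} there is y in prod {e_i,f_i} with
   S = sum_i (x_i + y_i); x (resp. y) is given by a choice vector of bools *)
Definition KG_game (S : nat) (q : seq (nat * nat * nat * nat)) : Prop :=
  forall x : seq bool, size x = size q ->
  exists y : seq bool, size y = size q /\
    S = (\sum_(i < size q)
           let: (a, b, e, f) := nth (0, 0, 0, 0)%N q i in
           ((if nth false x i then b else a) + (if nth false y i then f else e)))%N.

Definition LKG (w : seq kgsym) : Prop :=
  exists (S : seq bool) (blks : seq (seq bool * seq bool * seq bool * seq bool)),
    S != [::] /\
    all (fun blk : seq bool * seq bool * seq bool * seq bool =>
           let: (a, b, e, f) := blk in
           [&& a != [::], b != [::], e != [::] & f != [::]]) blks /\
    w = enc_KG S blks /\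
    KG_game (bitval S)
      (map (fun blk : seq bool * seq bool * seq bool * seq bool =>
              let: (a, b, e, f) := blk in (bitval a, bitval b, bitval e, bitval f)) blks).

(* Linear-space reductions: deterministic Turing transducers with a
   read-only two-way input tape ¢w$, one work tape, and a write-only
   one-way output tape.                                                 *)
Record lstm (S D : Type) := LSTM {
  mQ : finType;
  mG : finType;
  mblank : mG;
  mq0 : mQ;
  mhalt : pred mQ;
  (* state, input symbol, work symbol  |->
     new state, written work symbol, input move, work move, output symbol *)
  mdelta : mQ -> tsym S -> mG -> mQ * mG * move * move * option D;
  mc : nat
}.

Arguments mQ {S D}. Arguments mG {S D}. Arguments mblank {S D}. Arguments mq0 {S D}.
Arguments mhalt {S D}. Arguments mdelta {S D}. Arguments mc {S D}.

Record tmconf (S D : Type) (M : lstm S D) := TMConf {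
  cq : mQ M; cip : nat; ctape : nat -> mG M; cwp : nat; cout : seq D }.

Arguments TMConf {S D M}. Arguments cq {S D M}. Arguments cip {S D M}.
Arguments ctape {S D M}. Arguments cwp {S D M}. Arguments cout {S D M}.

Definition tm_init (S D : Type) (M : lstm S D) : tmconf S D M :=
  TMConf (mq0 M) 0 (fun _ => mblank M) 0 [::].

Definition tm_step (S D : Type) (M : lstm S D) (w : seq S) (c : tmconf S D M) : tmconf S D M :=
  if mhalt M (cq c) then c else
  let: (q', a, mi, mw, od) := mdelta M (cq c) (tape_at w (cip c)) (ctape c (cwp c)) in
  TMConf q' (move_in (size w).+1 mi (cip c))
    (fun i => if i == cwp c then a else ctape c i)
    (move_work mw (cwp c))
    (cout c ++ (if od is Some d then [:: d] else [::])).

Definition tm_run (S D : Type) (M : lstm S D) (w : seq S) (t : nat) : tmconf S D M :=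
  iter t (tm_step S D M w) (tm_init S D M).

Definition computes_linspace (S D : Type) (M : lstm S D) (f : seq S -> seq D) : Prop :=
  forall w : seq S,
    (exists T, mhalt M (cq (tm_run S D M w T)) /\ cout (tm_run S D M w T) = f w) /\
    (forall t, (cwp (tm_run S D M w t) < mc M * (size w).+1)%N).

Definition lin_space_reducible {S D : Type} (L : seq S -> Prop) (L' : seq D -> Prop) : Prop :=
  exists (M : lstm S D) (f : seq S -> seq D),
    computes_linspace S D M f /\ forall w, L w <-> L' (f w).

Local Open Scope ring_scope.

Record verifier (S : finType) := Verifier {
  vQ : finType;
  vG : finType;                       (* prover-to-verifier communication alphabet *)
  vr : nat;                           (* number of affine registers *)
  vdim : 'I_vr -> nat;
  vinit : forall k : 'I_vr, 'cV[rat]_(vdim k);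
  vq0 : vQ;
  vacc : pred vQ;
  vrej : pred vQ;
  (* for each register: Some M = apply affine operator M, None = weighting *)
  vop : vQ -> tsym S -> vG -> forall k : 'I_vr, option 'M[rat]_(vdim k);
  (* next state and head move, depending on the weighting outcomes
     (outcome of register k: Some j if weighted with result e_j, else None) *)
  vtr : vQ -> tsym S -> vG -> ('I_vr -> option nat) -> vQ * move
}.

Arguments vQ {S}. Arguments vG {S}. Arguments vr {S}. Arguments vdim {S}.
Arguments vinit {S}. Arguments vq0 {S}. Arguments vacc {S}. Arguments vrej {S}.
Arguments vop {S}. Arguments vtr {S}.

Definition affine_vec (n : nat) (v : 'cV[rat]_n) : bool := \sum_i v i 0 == 1.
Definition affine_op (n : nat) (M : 'M[rat]_n) : bool := [forall j, \sum_i M i j == 1].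

Definition wf_verifier (S : finType) (V : verifier S) : Prop :=
  (forall k, affine_vec _ (vinit V k)) /\
  (forall q s g k M, vop V q s g k = Some M -> affine_op _ M) /\
  (forall q, ~~ (vacc V q && vrej V q)).

Definition outcome {S : finType} (V : verifier S) := 'I_(vr V) -> option nat.

(* all-powerful prover: sees the whole history (its messages and all
   weighting outcomes, from which states and head moves are determined) *)
Definition prover {S : finType} (V : verifier S) :=
  seq (vG V * outcome V) -> vG V.

Definition wprob (n : nat) (v : 'cV[rat]_n) (j : nat) : rat :=
  (\sum_(i < n | val i == j) `|v i 0|) / (\sum_(i < n) `|v i 0|).

Definition basis (n : nat) (j : nat) : 'cV[rat]_n := \col_(i < n) ((val i == j)%:R).

Definition upd (I : eqType) (T : Type) (f : I -> T) (k : I) (x : T) : I -> T :=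
  fun k' => if k' == k then x else f k'.

Definition outcomes (S : finType) (V : verifier S)
    (regs : forall k, 'cV[rat]_(vdim V k)) (ops : forall k, option 'M[rat]_(vdim V k))
    : seq (rat * outcome V) :=
  foldr (fun k acc =>
           if ops k is None then
             flatten [seq [seq (po.1 * wprob _ (regs k) j, upd _ _ po.2 k (Some j))
                          | j <- iota 0 (vdim V k)] | po <- acc]
           else acc)
        [:: (1, fun _ => None)] (enum 'I_(vr V)).

Definition new_regs (S : finType) (V : verifier S)
    (regs : forall k, 'cV[rat]_(vdim V k)) (ops : forall k, option 'M[rat]_(vdim V k))
    (o : outcome V) : forall k, 'cV[rat]_(vdim V k) :=
  fun k => match ops k with Some M => M *m regs k | None => basis _ (odflt 0%N (o k)) end.

Fixpoint hprob (S : finType) (V : verifier S) (w : seq S) (P : prover V)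
    (target : pred (vQ V)) (t : nat) (q : vQ V) (pos : nat)
    (regs : forall k, 'cV[rat]_(vdim V k)) (hist : seq (vG V * outcome V)) {struct t} : rat :=
  if vacc V q || vrej V q then (target q)%:R else
  match t with
  | 0 => 0
  | t'.+1 =>
      let s := tape_at w pos in
      let g := P hist in
      let ops := vop V q s g in
      \sum_(po <- outcomes S V regs ops)
        po.1 * hprob S V w P target t' (vtr V q s g po.2).1
                 (move_in (size w).+1 (vtr V q s g po.2).2 pos)
                 (new_regs S V regs ops po.2) (rcons hist (g, po.2))
  end.

(* the probability of halting in [target] (the limit of hprob as t grows)
   is at least p *)
Definition halt_prob_ge (S : finType) (V : verifier S) (w : seq S) (P : prover V)
    (target : pred (vQ V)) (p : rat) : Prop :=
  forall d : rat, 0 < d ->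
    exists t, p - d <= hprob S V w P target t (vq0 V) 0 (vinit V) [::].

Definition verifies {S : finType} (V : verifier S) (L : seq S -> Prop) (eps : rat) : Prop :=
  wf_verifier S V /\
  (forall w, L w -> exists P : prover V, halt_prob_ge S V w P (vacc V) (1 - eps)) /\
  (forall w, ~ L w -> forall P : prover V, halt_prob_ge S V w P (vrej V) (1 - eps)).

Definition perfect_completeness {S : finType} (V : verifier S) (L : seq S -> Prop) : Prop :=
  forall w, L w -> exists P : prover V, halt_prob_ge S V w P (vacc V) 1.

(* Main.v *)
From Stdlib Require Import Classical ClassicalEpsilon FunctionalExtensionality.
Require Import Defs.
From HB Require Import structures.
From mathcomp Require Import all_boot all_order all_algebra.
From mathcomp Require Import ring lra zify.

(* The verifier works in rounds, in which it makes two passes over the output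
   of the reduction, simulating the Turing machine with the help of the prover.
   A configuration is a word aligned with the input tape; its value in a fixed
   base is held in an affine register.  At every step the prover spells out the
   current configuration; the verifier compares its value with the one predicted
   by the previous step, while predicting the next value, which is linear in the
   letters once the scanned symbols are known.  The comparison puts
   (D / eps, - D / eps, 1) in a register, where D is the difference: observing
   the last basis state is certain if D = 0 and has probability at most eps / 2
   if D is a nonzero integer.

   In the first pass coins choose x, in the second one the prover chooses y, and
   S - sum x - sum y is tested against 0 in the same way.  If the test succeeds,
   the verifier accepts only with a probability exponentially small in the
   number of coins, and otherwise starts a new round.  If w is not in L, some x
   is bad and is drawn with a probability larger than that of acceptance by a
   factor of order 1 / eps, so that each round increases the guaranteed
   probability of rejection by a fixed amount as long as it is below 1 - eps. *)

Set Implicit Arguments.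
Unset Strict Implicit.
Unset Printing Implicit Defensive.
Import Order.TTheory GRing.Theory Num.Theory.
Local Open Scope ring_scope.

Lemma descending_ind (P : nat -> Prop) n :
  P n -> (forall i, (i < n)%N -> P i.+1 -> P i) -> forall i, (i <= n)%N -> P i.
Proof.
move=> Pn PS i; have [d Ed] : exists d, (n - i)%N = d by exists (n - i)%N.
elim: d i Ed => [|d IHd] i Ed le_in; first by have -> : i = n by lia.
by apply: PS; [lia|apply: IHd; lia].
Qed.

Lemma natr_dist_ge1 (R : archiNumDomainType) (m n : nat) : m != n -> 1 <= `|m%:R - n%:R : R|.
Proof.
rewrite -(eqr_nat R) -subr_eq0 => ne_mn; apply: norm_intr_ge1 ne_mn.
by rewrite rpredB ?rpred_nat.
Qed.

Lemma archi_climb (R : archiRealFieldType) (A : R -> Prop) (start gain target : R) :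
  0 < gain -> A start -> (forall v, A v -> start <= v -> v < target -> A (v + gain)) ->
  exists2 v, target <= v & A v.
Proof.
move=> gain_gt0 A_start step.
have climbed n : (exists2 v, target <= v & A v) \/ A (start + gain *+ n).
  elim: n => [|n [?|A_n]]; [by right; rewrite addr0|by left|].
  have [le_n|lt_n] := lerP target (start + gain *+ n); first by left; exists (start + gain *+ n).
  right; rewrite mulrSr addrA; apply: step => //.
  by rewrite lerDl mulrn_wge0 // ltW.
set n := Num.bound `|(target - start) / gain|; have [//|A_n] := climbed n.
exists (start + gain *+ n) => //; rewrite -lerBlDl -mulr_natl -ler_pdivrMr //.
by apply: le_trans (ler_norm _) (ltW (archi_boundP _)).
Qed.

Lemma fin_exists_uniform (I : finType) (D : pred I) (A : I -> nat -> Prop) :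
  (forall i m n, (m <= n)%N -> A i m -> A i n) ->
  (forall i, D i -> exists n, A i n) -> exists n, forall i, D i -> A i n.
Proof.
move=> mono exA; have /fin_all_exists[f Af] : forall i, exists n, D i -> A i n.
  by move=> i; have [/exA[n An]|_] := boolP (D i); [exists n|exists 0%N].
by exists (\max_i f i)%N => i Di; exact: mono (leq_bigmax i) (Af i Di).
Qed.

Definition least (P : nat -> Prop) (n : nat) : Prop := P n /\ forall m, P m -> (n <= m)%N.

Lemma ex_least (P : nat -> Prop) n : P n -> exists2 m, (m <= n)%N & least P m.
Proof.
elim/ltn_ind: n => n IHn Pn.
have [[m lt_mn Pm]|minimal] := classic (exists2 m, (m < n)%N & P m).
  by have [k le_km] := IHn m lt_mn Pm; exists k => //; exact: leq_trans le_km (ltnW lt_mn).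
exists n => //; split=> // m Pm; rewrite leqNgt; apply/negP=> lt_mn.
by apply: minimal; exists m.
Qed.

(** * Finite games against chance *)

Record game (R : archiRealFieldType) := Game {
  position : Type;
  message : finType;
  branch : finType;
  observation : Type;
  weight : position -> message -> branch -> R;
  observe : position -> message -> branch -> observation;
  next : position -> message -> observation -> position;
  accepting : pred position;
  rejecting : pred position;
  weight_ge0 : forall c g b, 0 <= weight c g b;
  sum_weight : forall c g, \sum_b weight c g b = 1 }.

Arguments accepting {R _}.
Arguments rejecting {R _}.

Section Game.
Variables (R : archiRealFieldType) (G : game R).
Local Notation conf := (position G).
Local Notation msg := (message G).
Local Notation history := (seq (message G * observation G)).
Implicit Types (c d : conf) (g : msg) (P : history -> msg) (hist : history).

Definition halted c : bool := accepting c || rejecting c.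

Definition after c g (b : branch G) : conf := next c g (observe c g b).

Fixpoint play P (target : pred conf) (t : nat) c hist : R :=
  if halted c then (target c)%:R else
  if t is t'.+1 then
    \sum_b weight c (P hist) b *
      play P target t' (after c (P hist) b) (rcons hist (P hist, observe c (P hist) b))
  else 0.

Lemma ler_sum_weight c g (u v : branch G -> R) :
  (forall b, 0 < weight c g b -> u b <= v b) ->
  \sum_b weight c g b * u b <= \sum_b weight c g b * v b.
Proof.
move=> le_uv; apply: ler_sum => b _; have := weight_ge0 c g b; rewrite le_eqVlt.
by case/predU1P=> [<-|w_gt0]; rewrite ?mul0r // ler_pM2l ?le_uv.
Qed.

Lemma sum_weight_const c g v : \sum_b weight c g b * v = v.
Proof. by rewrite -mulr_suml sum_weight mul1r. Qed.

Lemma play_halted P target t c hist : halted c -> play P target t c hist = (target c)%:R.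
Proof. by case: t => [|t] /= ->. Qed.

Lemma play_running P target t c hist : ~~ halted c -> play P target t.+1 c hist =
  \sum_b weight c (P hist) b *
    play P target t (after c (P hist) b) (rcons hist (P hist, observe c (P hist) b)).
Proof. by move=> /= /negPf ->. Qed.

Lemma play_ge0 P target t c hist : 0 <= play P target t c hist.
Proof.
elim: t c hist => [|t IHt] c hist /=; case: ifP => _ //; rewrite ?ler0n //.
by apply: sumr_ge0 => b _; rewrite mulr_ge0 ?weight_ge0.
Qed.

Lemma play_mono P target s t c hist :
  (s <= t)%N -> play P target s c hist <= play P target t c hist.
Proof.
elim: s t c hist => [|s IHs] [|t] c hist //= le_st; case: ifP => // _.
  by apply: sumr_ge0 => b _; rewrite mulr_ge0 ?weight_ge0 ?play_ge0.
by apply: ler_sum_weight => b _; exact: IHs.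
Qed.

Lemma play_ge_sum P target c hist (u : branch G -> R) : ~~ halted c ->
  (forall b, 0 < weight c (P hist) b -> exists t, u b <=
     play P target t (after c (P hist) b) (rcons hist (P hist, observe c (P hist) b))) ->
  exists t, \sum_b weight c (P hist) b * u b <= play P target t c hist.
Proof.
move=> running /fin_exists_uniform[b s t le_st le_s|t le_t].
  exact: le_trans le_s (play_mono _ _ _ _ le_st).
by exists t.+1; rewrite play_running // ler_sum_weight.
Qed.

Definition forced_within (t : nat) (v : R) c : Prop :=
  forall P hist, v <= play P rejecting t c hist.

Definition forced (v : R) c : Prop := exists t, forced_within t v c.

Lemma forced_within_mono s t v c : (s <= t)%N -> forced_within s v c -> forced_within t v c.
Proof. by move=> le_st le_v P hist; apply: le_trans (le_v P hist) (play_mono _ _ _ _ le_st). Qed.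

Lemma forced_le v v' c : v' <= v -> forced v c -> forced v' c.
Proof. by move=> le_v [t le_t]; exists t => P hist; exact: le_trans le_v (le_t P hist). Qed.

Lemma forced0 c : forced 0 c.
Proof. by exists 0%N => P hist; exact: play_ge0. Qed.

Lemma forced_rejecting v c : rejecting c -> v <= 1 -> forced v c.
Proof. by move=> rej le_v1; exists 0%N => P hist; rewrite play_halted /halted rej ?orbT. Qed.

Definition advances (W : conf -> Prop) c g : Prop :=
  forall b, 0 < weight c g b -> W (after c g b).

Lemma advances_sub (W W' : conf -> Prop) c g :
  (forall d, W d -> W' d) -> advances W c g -> advances W' c g.
Proof. by move=> sWW' adv b /adv/sWW'. Qed.

(* As there are finitely many messages, the time needed does not depend on the prover. *)
Lemma forced_step v c : ~~ halted c ->
  (forall g, exists u : branch G -> R,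
     (forall b, 0 < weight c g b -> forced (u b) (after c g b)) /\
     v <= \sum_b weight c g b * u b) ->
  forced v c.
Proof.
move=> running forced_after.
pose A g t := exists u : branch G -> R,
  (forall b, 0 < weight c g b -> forced_within t (u b) (after c g b)) /\
  v <= \sum_b weight c g b * u b.
have [g s t le_st [u [le_u le_v]]|g _|t At] := @fin_exists_uniform msg xpredT A.
- by exists u; split=> // b /le_u; exact: forced_within_mono le_st.
- have [u [u_forced le_v]] := forced_after g.
  move: u_forced => /fin_exists_uniform[b s t le_st|t le_u]; first exact: forced_within_mono le_st.
  by exists t, u.
exists t.+1 => P hist; rewrite play_running //; have [u [le_u le_v]] := At (P hist) isT.
by apply: le_trans le_v _; apply: ler_sum_weight => b w_gt0; exact: le_u.
Qed.

Lemma forced_all v c : ~~ halted c -> (forall g, advances (forced v) c g) -> forced v c.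
Proof.
move=> running adv; apply: forced_step => // g; exists (fun=> v).
by rewrite sum_weight_const; split=> //; exact: adv.
Qed.

(* A closure property shared by [safe] and [forced v], so that the honest moves
   are analysed once, for completeness and for soundness. *)
Definition honest_closed (caught : R) (W : conf -> Prop) : Prop := forall c, ~~ halted c ->
  (exists g, advances W c g) -> (forall g, advances W c g \/ advances (forced caught) c g) -> W c.

Lemma honest_closed_forced caught v : v <= caught -> honest_closed caught (forced v).
Proof.
move=> le_v c running _ adv; apply: forced_all => // g.
by case: (adv g) => //; apply: advances_sub => d; exact: forced_le.
Qed.

Section Honest.
Variable checkpoint : conf -> Prop.

Fixpoint reach (n : nat) c : Prop :=
  checkpoint c \/
  if n is n'.+1 then ~~ halted c /\ exists g, advances (reach n') c g else False.

Definition safe c : Prop := exists n, reach n c.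

Lemma reach_mono m n c : (m <= n)%N -> reach m c -> reach n c.
Proof.
elim: m n c => [|m IHm] [|n] c //= le_mn; first by case=> // ?; left.
case=> [?|[running [g adv]]]; [by left|right; split=> //; exists g].
by apply: advances_sub adv => d; exact: IHm.
Qed.

Lemma safe_checkpoint c : checkpoint c -> safe c.
Proof. by move=> ?; exists 0%N; left. Qed.

Lemma safe_step c g : ~~ halted c -> advances safe c g -> safe c.
Proof.
move=> running /fin_exists_uniform[b m n le_mn|n adv]; first exact: reach_mono le_mn.
by exists n.+1; right; split=> //; exists g.
Qed.

Lemma honest_closed_safe caught : honest_closed caught safe.
Proof. by move=> c running [g adv] _; exact: safe_step adv. Qed.

Variables (g0 : msg) (c0 : conf).

(* Descending along the least level reaches a checkpoint in finitely many moves. *)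
Definition descent c : msg :=
  epsilon (inhabits g0) (fun g => forall n, least (reach^~ c) n.+1 -> advances (reach n) c g).

Lemma descentP c n : least (reach^~ c) n.+1 -> advances (reach n) c (descent c).
Proof.
move=> least_n; apply: (epsilon_spec (inhabits g0)
  (fun g => forall n, least (reach^~ c) n.+1 -> advances (reach n) c g)) (least_n).
have [[fin|[_ [g adv]]] min_n] := least_n; first by have := min_n 0%N (or_introl fin).
exists g => m [reach_m min_m]; suff -> : m = n by [].
by apply/eqP; rewrite eqn_leq; apply/andP; split; [exact: min_m least_n.1|exact: min_n reach_m].
Qed.

Definition replay (hist : history) : conf :=
  foldl (fun c go => next c go.1 go.2) c0 hist.

Definition honest (hist : history) : msg := descent (replay hist).

Lemma replay_rcons hist g o : replay (rcons hist (g, o)) = next (replay hist) g o.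
Proof. by rewrite /replay foldl_rcons. Qed.

Variable alpha : R.
Hypothesis alpha_gt0 : 0 < alpha.
Hypothesis checkpoint_wins : forall c, checkpoint c -> ~~ halted c /\ forall g,
  alpha <= \sum_(b | accepting (after c g b)) weight c g b /\
  advances (fun d => accepting d \/ safe d) c g.

Definition secured (v : R) : Prop := forall hist, safe (replay hist) ->
  exists t, v <= play honest accepting t (replay hist) hist.

Lemma secured_checkpoint v delta hist : 0 < delta -> v < 1 - delta -> secured v ->
  checkpoint (replay hist) ->
  exists t, v + alpha * delta <= play honest accepting t (replay hist) hist.
Proof.
set c := replay hist => delta_gt0 lt_v sec fin.
have [running /(_ (honest hist))[le_alpha adv]] := checkpoint_wins fin.
pose u b := if accepting (after c (honest hist) b) then 1 else v.
have [|t le_t] := @play_ge_sum honest accepting c hist u running.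
  move=> b /adv; rewrite /u; case: ifP => [acc _|_ [//|sf]].
    by exists 0%N; rewrite play_halted /halted acc.
  by rewrite /after -replay_rcons; apply: sec; rewrite replay_rcons.
exists t; apply: le_trans le_t.
have -> : \sum_b weight c (honest hist) b * u b = v +
    (\sum_(b | accepting (after c (honest hist) b)) weight c (honest hist) b) * (1 - v).
  rewrite -[X in X + _](sum_weight_const c (honest hist)) mulr_suml.
  rewrite [X in _ + X]big_mkcond -big_split.
  by apply: eq_bigr => b _; rewrite /u; case: ifP => _ /=; ring.
by rewrite lerD2l ler_pM // ltW //; lra.
Qed.

Lemma secured_gain v delta : 0 < delta -> v < 1 - delta -> secured v -> secured (v + alpha * delta).
Proof.
move=> delta_gt0 lt_v sec hist [n]; elim/ltn_ind: n hist => n IHn hist /(@ex_least (reach^~ _)).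
case=> -[_ [[fin|//] _]|m lt_mn least_m]; first exact: secured_checkpoint.
have [fin|[running _]] := least_m.1; first exact: secured_checkpoint.
pose u (b : branch G) := v + alpha * delta.
have [|t le_t] := @play_ge_sum honest accepting (replay hist) hist u running.
  move=> b /(descentP least_m); rewrite -[descent _]/(honest hist) => reach_m.
  by rewrite /after -replay_rcons; apply: (IHn m) => //; rewrite replay_rcons.
by exists t; rewrite sum_weight_const in le_t.
Qed.

Lemma honest_accepts delta : safe c0 -> 0 < delta ->
  exists t, 1 - delta <= play honest accepting t c0 [::].
Proof.
move=> safe0 delta_gt0; have [v le_v sec] : exists2 v, 1 - delta <= v & secured v.
  apply: (@archi_climb _ secured 0 (alpha * delta)); first exact: mulr_gt0.
    by move=> hist _; exists 0%N; exact: play_ge0.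
  by move=> v sec _ lt_v; exact: secured_gain.
by have [t le_t] := sec [::] safe0; exists t; exact: le_trans le_v le_t.
Qed.

End Honest.
End Game.

Arguments after : simpl never.

(** * Programs over affine registers *)

Record aff := Aff { a11 : rat; a12 : rat; a21 : rat; a22 : rat; b1 : rat; b2 : rat }.

Definition aff_app (f : aff) (p : rat * rat) : rat * rat :=
  (a11 f * p.1 + a12 f * p.2 + b1 f, a21 f * p.1 + a22 f * p.2 + b2 f).

Arguments aff_app : simpl never.
Coercion aff_app : aff >-> Funclass.

Definition aff_id : aff := Aff 1 0 0 1 0 0.
Definition aff_const (p : rat * rat) : aff := Aff 0 0 0 0 p.1 p.2.
Definition aff_scale (r : rat) : aff := Aff r 0 0 r 0 0.
Definition aff_fst (r d : rat) : aff := Aff r 0 0 1 d 0.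
Definition aff_snd (r d : rat) : aff := Aff 1 0 0 r 0 d.
Definition aff_proj (a : rat) : aff := Aff 1 a 0 0 0 0.
Definition aff_test (r s : rat) : aff := Aff r s (- r) (- s) 0 0.

Definition spread (x : rat) : rat * rat := (x, - x).

Lemma aff_idE p : aff_id p = p.
Proof. by case: p => x y; rewrite /aff_app /=; congr pair; ring. Qed.

Lemma aff_constE p q : aff_const p q = p.
Proof. by case: p => x y; rewrite /aff_app /=; congr pair; ring. Qed.

Lemma aff_scale_spread r x : aff_scale r (spread x) = spread (r * x).
Proof. by rewrite /aff_app /=; congr pair; ring. Qed.

Lemma aff_fstE r d x y : aff_fst r d (x, y) = (r * x + d, y).
Proof. by rewrite /aff_app /=; congr pair; ring. Qed.

Lemma aff_sndE r d x y : aff_snd r d (x, y) = (x, r * y + d).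
Proof. by rewrite /aff_app /=; congr pair; ring. Qed.

Lemma aff_projE a x y : aff_proj a (x, y) = (x + a * y, 0).
Proof. by rewrite /aff_app /=; congr pair; ring. Qed.

Lemma aff_testE r s x y : aff_test r s (x, y) = spread (r * x + s * y).
Proof. by rewrite /aff_app /=; congr pair; ring. Qed.

Definition aff_vec (p : rat * rat) : 'cV[rat]_3 :=
  \col_i nth 0 [:: p.1; p.2; 1 - p.1 - p.2] i.

(* As the coordinates of a register sum to 1, the translation part of [f] can
   be added to every column. *)
Definition aff_mx (f : aff) : 'M[rat]_3 :=
  \matrix_(i, j)
    let u := nth 0 [:: a11 f; a12 f; 0] j + b1 f in
    let v := nth 0 [:: a21 f; a22 f; 0] j + b2 f in
    nth 0 [:: u; v; 1 - u - v] i.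

Lemma affine_aff_vec p : affine_vec 3 (aff_vec p).
Proof. by apply/eqP; rewrite !big_ord_recl big_ord0 !mxE /=; ring. Qed.

Lemma affine_op_aff_mx f : affine_op 3 (aff_mx f).
Proof. by apply/forallP=> j; apply/eqP; rewrite !big_ord_recl big_ord0 !mxE /=; ring. Qed.

Lemma mul_aff_mx f p : aff_mx f *m aff_vec p = aff_vec (f p).
Proof.
apply/colP=> i; rewrite !mxE !big_ord_recl big_ord0 !mxE /=.
by case: i => -[|[|[|//]]] /= _; ring.
Qed.

Lemma basis_aff_vec j : (j < 3)%N -> basis 3 j = aff_vec ((j == 0%N)%:R, (j == 1%N)%:R).
Proof.
move=> lt_j; apply/colP=> i; rewrite !mxE.
by case: i => -[|[|[|//]]] ?; case: j lt_j => [|[|[|//]]] _ //=; rewrite ?subr0 ?subrr ?sub0r.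
Qed.

Lemma wprob_ge0 n v j : 0 <= wprob n v j.
Proof. by rewrite /wprob divr_ge0 // sumr_ge0. Qed.

Lemma sum_wprob n v : affine_vec n v -> \sum_(j < n) wprob n v j = 1.
Proof.
move=> /eqP sum_v; rewrite -mulr_suml.
have -> : \sum_(j < n) \sum_(i < n | val i == j) `|v i 0| = \sum_(i < n) `|v i 0|.
  by apply: eq_bigr => j _; rewrite (big_pred1 j).
rewrite divff // gt_eqF //; apply: lt_le_trans ltr01 _.
by rewrite -[1]normr1 -sum_v ler_norm_sum.
Qed.

Definition prob_last (p : rat * rat) : rat := wprob 3 (aff_vec p) 2.

Lemma prob_lastE p :
  prob_last p = `|1 - p.1 - p.2| / (`|p.1| + (`|p.2| + `|1 - p.1 - p.2|)).
Proof.
by rewrite /prob_last /wprob big_mkcond /= !big_ord_recl !big_ord0 !mxE /= !addr0 !add0r.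
Qed.

Lemma prob_last_spread x : prob_last (spread x) = (1 + 2 * `|x|)^-1.
Proof. by rewrite prob_lastE /= normrN opprK addrNK normr1 mul1r; congr _^-1; ring. Qed.

Lemma prob_last_spread0 : prob_last (spread 0) = 1.
Proof. by rewrite prob_last_spread normr0 mulr0 addr0 invr1. Qed.

Lemma prob_last_spread_le e x : 0 < e -> 1 <= `|x| -> prob_last (spread (e^-1 * x)) <= e / 2.
Proof.
move=> e_gt0 x_ge1; rewrite prob_last_spread normrM normfV (gtr0_norm e_gt0).
have lower : e^-1 <= e^-1 * `|x| by rewrite ler_peMr // invr_ge0 ltW.
have inv_gt0 : 0 < e^-1 by rewrite invr_gt0.
by rewrite -[e / 2]invrK lef_pV2 ?posrE ?invf_div ?divr_gt0 //; lra.
Qed.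

Lemma prob_last_half : prob_last (1 / 2, 0) = 1 / 2.
Proof. by rewrite prob_lastE. Qed.

Lemma prob_last_ge0 p : 0 <= prob_last p.
Proof. exact: wprob_ge0. Qed.

Lemma wprob_not_last p : wprob 3 (aff_vec p) 0 + wprob 3 (aff_vec p) 1 = 1 - prob_last p.
Proof.
apply/eqP; rewrite eq_sym subr_eq -(sum_wprob (affine_aff_vec p)).
by rewrite !big_ord_recl big_ord0 addr0 addrA.
Qed.

Lemma prob_last_le1 p : prob_last p <= 1.
Proof. by rewrite -subr_ge0 -wprob_not_last addr_ge0 ?wprob_ge0. Qed.

Section Outcomes.
Variables (S : finType) (V : verifier S).
Variables (regs : forall k, 'cV[rat]_(vdim V k)) (ops : forall k, option 'M[rat]_(vdim V k)).

Lemma outcomes_ops : (forall k, ops k <> None) -> outcomes S V regs ops = [:: (1, fun=> None)].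
Proof.
move=> ops_some; rewrite /outcomes; elim: (enum _) => //= k l ->.
by have := @ops_some k; case: (ops k).
Qed.

Lemma outcomes_weighing k : ops k = None -> (forall i, i != k -> ops i <> None) ->
  outcomes S V regs ops =
  [seq (wprob _ (regs k) j, upd _ _ (fun=> None) k (Some j)) | j <- iota 0 (vdim V k)].
Proof.
move=> ops_k ops_some; rewrite /outcomes; set op := fun _ _ => _.
have skip l : k \notin l -> foldr op [:: (1, fun=> None)] l = [:: (1, fun=> None)].
  elim: l => //= i l IHl; rewrite inE negb_or eq_sym => /andP[/ops_some + /IHl ->].
  by rewrite /op; case: (ops i).
have : k \in enum 'I_(vr V) by rewrite mem_enum.
have := enum_uniq 'I_(vr V); elim: (enum _) => //= i l IHl /andP[il uniq_l].
rewrite inE; case: eqVneq => [Ek _|ne_ik /= kl].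
  rewrite -{i}Ek in il *; rewrite skip // /op ops_k /= cats0.
  by apply: eq_map => j; rewrite mul1r.
rewrite IHl // /op; have := @ops_some i; rewrite eq_sym ne_ik.
by case: (ops i) => // /(_ isT).
Qed.

End Outcomes.

Lemma halt_prob_ge_le (S : finType) (V : verifier S) w P target p p' : p' <= p ->
  halt_prob_ge S V w P target p -> halt_prob_ge S V w P target p'.
Proof.
move=> le_p prob_p d /prob_p[t le_t]; exists t; apply: le_trans le_t.
by rewrite lerD2r.
Qed.

Section Program.
Variables (S Q G K : finType) (q0 : Q) (acc rej : pred Q).

Local Notation store := (K -> rat * rat).
Local Notation set_reg z k p := (upd _ _ z k p).

(* [Weigh k yes no] continues in [yes] when the last basis state of register [k]
   is observed, and in [no] otherwise. *)
Inductive instr := Update of (K -> aff) & Q & move | Weigh of K & Q & Q.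

Definition instr_op (a : instr) (i : 'I_#|K|) : option 'M[rat]_3 :=
  match a with
  | Update f _ _ => Some (aff_mx (f (enum_val i)))
  | Weigh k _ _ => if i == enum_rank k then None else Some (aff_mx aff_id)
  end.

Definition instr_move (a : instr) (o : 'I_#|K| -> option nat) : Q * move :=
  match a with
  | Update _ q m => (q, m)
  | Weigh k yes no => (if o (enum_rank k) == Some 2%N then yes else no, MStay)
  end.

Definition update (f : K -> aff) (z : store) : store := fun k => f k (z k).

Definition instr_store (a : instr) (z : store) (o : 'I_#|K| -> option nat) : store :=
  match a with
  | Update f _ _ => update f z
  | Weigh k _ _ =>
      let j := odflt 0%N (o (enum_rank k)) in set_reg z k ((j == 0%N)%:R, (j == 1%N)%:R)
  end.

Definition instr_outcome (a : instr) (j : 'I_3) : 'I_#|K| -> option nat :=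
  if a is Weigh k _ _ then upd _ _ (fun=> None) (enum_rank k) (Some (j : nat)) else fun=> None.

Definition instr_weight (a : instr) (z : store) (j : 'I_3) : rat :=
  if a is Weigh k _ _ then wprob 3 (aff_vec (z k)) j else (j == ord0)%:R.

Lemma instr_weight_ge0 a z j : 0 <= instr_weight a z j.
Proof. by case: a => *; rewrite ?wprob_ge0 ?ler0n. Qed.

Lemma sum_instr_weight a z : \sum_j instr_weight a z j = 1.
Proof.
case: a => [f q m|k yes no]; last exact/sum_wprob/affine_aff_vec.
by rewrite (bigD1 ord0) //= big1 ?addr0 // => j /negPf ->.
Qed.

Variable prog : Q -> tsym S -> G -> instr.

Definition prog_verifier : verifier S :=
  @Verifier S Q G #|K| (fun=> 3%N) (fun=> aff_vec (0, 0)) q0 acc rej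
    (fun q s g => instr_op (prog q s g)) (fun q s g => instr_move (prog q s g)).

Local Notation V := prog_verifier.

Lemma wf_prog_verifier : (forall q, ~~ (acc q && rej q)) -> wf_verifier S V.
Proof.
move=> acc_rej; split; first by move=> i; exact: affine_aff_vec.
split=> // q s g i A /=; case: prog => [f _ _|k _ _] /=.
  by case=> <-; exact: affine_op_aff_mx.
by case: eqP => // _ [<-]; exact: affine_op_aff_mx.
Qed.

Definition vectors (z : store) : forall i : 'I_(vr V), 'cV[rat]_(vdim V i) :=
  fun i => aff_vec (z (enum_val i)).

Lemma new_regs_instr a z j : new_regs S V (vectors z) (instr_op a) (instr_outcome a j) =
  vectors (instr_store a z (instr_outcome a j)).
Proof.
apply: functional_extensionality_dep => i; rewrite /new_regs.
case: a => [f q m|k yes no] /=; first by rewrite mul_aff_mx.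
rewrite /vectors /upd eqxx (can2_eq enum_valK enum_rankK).
by case: eqP => _; [exact: (basis_aff_vec (ltn_ord j))|rewrite mul_aff_mx aff_idE].
Qed.

Lemma sum_outcomes a z (F : outcome V -> rat) :
  \sum_(po <- outcomes S V (vectors z) (instr_op a)) po.1 * F po.2 =
  \sum_j instr_weight a z j * F (instr_outcome a j).
Proof.
case: a => [f q m|k yes no].
  by rewrite outcomes_ops //= big_seq1 -mulr_suml (bigD1 ord0) //= big1 ?addr0 // => j /negPf ->.
have op_k : instr_op (Weigh k yes no) (enum_rank k) = None by rewrite /= eqxx.
have op_other i : i != enum_rank k -> instr_op (Weigh k yes no) i <> None by move=> /negPf /= ->.
rewrite (@outcomes_weighing S V _ _ _ op_k op_other) big_map -[iota _ _]/(index_iota 0 3) big_mkord.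
by apply: eq_bigr => j _; rewrite /vectors enum_rankK.
Qed.

Record conf := Conf { st : Q; hd : nat; rg : store }.

Variable w : seq S.

Definition instr_at (c : conf) (g : G) : instr := prog (st c) (tape_at w (hd c)) g.

Definition next_conf (c : conf) (g : G) (o : outcome V) : conf :=
  let a := instr_at c g in
  Conf (instr_move a o).1 (move_in (size w).+1 (instr_move a o).2 (hd c)) (instr_store a (rg c) o).

Definition prog_game : game rat :=
  @Game rat conf G 'I_3 (outcome V) (fun c g => instr_weight (instr_at c g) (rg c))
    (fun c g => instr_outcome (instr_at c g)) next_conf (fun c => acc (st c)) (fun c => rej (st c))
    (fun c g => instr_weight_ge0 (instr_at c g) (rg c))
    (fun c g => sum_instr_weight (instr_at c g) (rg c)).

Local Notation game := prog_game.
Implicit Types (c : position game) (W : position game -> Prop).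

Lemma hprob_play (P : prover V) (target : pred Q) t c hist :
  hprob S V w P target t (st c) (hd c) (vectors (rg c)) hist =
  @play _ game P (fun d => target (st d)) t c hist.
Proof.
elim: t c hist => [//|t IHt] c hist; rewrite /= -[_ || _]/(halted c); case: ifP => // _.
set a := instr_at c (P hist); pose F o :=
  hprob S V w P target t (instr_move a o).1 (move_in (size w).+1 (instr_move a o).2 (hd c))
    (new_regs S V (vectors (rg c)) (instr_op a) o) (rcons hist (P hist, o)).
rewrite -[LHS]/(\sum_(po <- outcomes S V (vectors (rg c)) (instr_op a)) po.1 * F po.2) sum_outcomes.
by apply: eq_bigr => j _; rewrite /F new_regs_instr -IHt.
Qed.

Definition start_conf : position game := Conf q0 0 (fun=> (0, 0)).

Lemma forced_verifier v : forced v start_conf -> forall P, halt_prob_ge S V w P rej v.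
Proof.
case=> t le_t P d d_gt0; exists t; rewrite -[vinit V]/(vectors (rg start_conf)).
by rewrite (hprob_play _ _ _ start_conf); apply: le_trans (le_t P [::]); lra.
Qed.

Lemma advances_update W c g f q m : instr_at c g = Update f q m ->
  W (Conf q (move_in (size w).+1 m (hd c)) (update f (rg c))) -> advances W c g.
Proof. by move=> E Wnext j _; rewrite /after /= /next_conf E. Qed.

Lemma after_weigh c g (j : 'I_3) k yes no : instr_at c g = Weigh k yes no ->
  @after _ game c g j = Conf (if (j == 2 :> nat)%N then yes else no) (hd c)
    (set_reg (rg c) k ((j == 0 :> nat)%N%:R, (j == 1 :> nat)%N%:R)).
Proof. by rewrite /after /= /next_conf => ->; rewrite /= /upd eqxx. Qed.

Lemma advances_weigh W c g k yes no : instr_at c g = Weigh k yes no ->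
  (forall p, W (Conf yes (hd c) (set_reg (rg c) k p))) ->
  (prob_last (rg c k) < 1 -> forall p, W (Conf no (hd c) (set_reg (rg c) k p))) ->
  advances W c g.
Proof.
move=> E Wyes Wno j; rewrite (after_weigh _ E) /= E /= => wj_gt0.
case: ifP => [//|ne_j2]; apply: Wno; rewrite -subr_gt0 -wprob_not_last.
case: j ne_j2 wj_gt0 => -[|[|[|//]]] //= _ _ wj_gt0; first by rewrite ltr_wpDr ?wprob_ge0.
by rewrite ltr_wpDl ?wprob_ge0.
Qed.

Lemma forced_weigh v vyes vno c k yes no : ~~ halted c ->
  (forall g, instr_at c g = Weigh k yes no) ->
  (forall p, @forced _ game vyes (Conf yes (hd c) (set_reg (rg c) k p))) ->
  (forall p, @forced _ game vno (Conf no (hd c) (set_reg (rg c) k p))) ->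
  v <= prob_last (rg c k) * vyes + (1 - prob_last (rg c k)) * vno -> forced v c.
Proof.
move=> run E Fyes Fno le_v; apply: forced_step run _ => g.
exists (fun j : 'I_3 => if (j == 2 :> nat)%N then vyes else vno); split.
  by move=> j _; rewrite (after_weigh _ (E g)); case: ifP.
by rewrite /= E !big_ord_recl big_ord0 addr0 /= addrA -mulrDl wprob_not_last addrC.
Qed.

Lemma safe_verifier (checkpoint : position game -> Prop) (g0 : G) alpha : 0 < alpha ->
  (forall c, checkpoint c -> ~~ halted c /\ exists k yes no,
     [/\ forall g, instr_at c g = Weigh k yes no, acc yes, alpha <= prob_last (rg c k)
       & forall p, safe checkpoint (Conf no (hd c) (set_reg (rg c) k p))]) ->
  safe checkpoint start_conf -> exists P, halt_prob_ge S V w P acc 1.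
Proof.
move=> alpha_gt0 wins safe0; exists (@honest _ game checkpoint g0 start_conf) => d d_gt0.
have [|t le_t] := @honest_accepts _ game checkpoint g0 start_conf alpha alpha_gt0 _ d safe0 d_gt0.
  move=> c /wins[run [k [yes [no [E acc_yes le_alpha safe_no]]]]]; split=> // g.
  split; last by apply: advances_weigh (E g) _ _ => [|_] p; [left|right; exact: safe_no].
  apply: le_trans le_alpha _; rewrite (bigD1 ord_max); last by rewrite (after_weigh _ (E g)).
  by rewrite /= E lerDl sumr_ge0 // => j _; exact: wprob_ge0.
by exists t; rewrite -[vinit V]/(vectors (rg start_conf)) (hprob_play _ _ _ start_conf).
Qed.

Section Closed.
Variables (caught : rat) (W : position game -> Prop) (g0 : G).
Hypothesis closedW : honest_closed caught W.

Lemma closed_advances c : ~~ halted c -> (forall g, advances W c g) -> W c.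
Proof. by move=> run adv; apply: closedW => //; [exists g0|left]. Qed.

Lemma closed_update c f q m : ~~ halted c -> (forall g, instr_at c g = Update f q m) ->
  W (Conf q (move_in (size w).+1 m (hd c)) (update f (rg c))) -> W c.
Proof.
by move=> run E Wnext; apply: closed_advances => // g; exact: advances_update (E g) Wnext.
Qed.

Lemma closed_weigh c k yes no : ~~ halted c -> (forall g, instr_at c g = Weigh k yes no) ->
  (forall p, W (Conf yes (hd c) (set_reg (rg c) k p))) ->
  (prob_last (rg c k) < 1 -> forall p, W (Conf no (hd c) (set_reg (rg c) k p))) -> W c.
Proof.
by move=> run E Wyes Wno; apply: closed_advances => // g; exact: advances_weigh (E g) Wyes Wno.
Qed.

End Closed.
End Program.

(** * The knapsack game as a run of a nondeterministic parser *)

(* [PTarget ne]: reading [S]; [PQuant q], [POpen q]: expecting the quantifier and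
   the opening parenthesis of a universal or existential ([q]) pair;
   [PNum q snd ne ch]: reading its first or second ([snd]) number.  [ne] records
   that a digit was read and [ch] which number of the pair was chosen. *)
Inductive pstate :=
  PTarget of bool | PQuant of bool | POpen of bool | PNum of bool & bool & bool & bool | PErr.

Definition pstate_code (p : pstate) : option (bool + (bool + (bool + bool * bool * bool * bool))) :=
  match p with
  | PTarget ne => Some (inl ne)
  | PQuant q => Some (inr (inl q))
  | POpen q => Some (inr (inr (inl q)))
  | PNum q s ne ch => Some (inr (inr (inr (q, s, ne, ch))))
  | PErr => None
  end.

Definition pstate_decode (u : option (bool + (bool + (bool + bool * bool * bool * bool)))) :
    pstate :=
  match u with
  | Some (inl ne) => PTarget ne
  | Some (inr (inl q)) => PQuant q
  | Some (inr (inr (inl q))) => POpen q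
  | Some (inr (inr (inr (q, s, ne, ch)))) => PNum q s ne ch
  | None => PErr
  end.

Lemma pstate_codeK : cancel pstate_code pstate_decode.
Proof. by case. Qed.

HB.instance Definition _ := Finite.copy pstate (can_type pstate_codeK).

Definition pnext (c : bool) (p : pstate) (d : kgsym) : pstate :=
  match p, d with
  | PTarget _, (K0 | K1) => PTarget true
  | (PTarget true | PQuant false), KAll => POpen false
  | PQuant true, KEx => POpen true
  | POpen q, KLp => PNum q false false c
  | PNum q s _ ch, (K0 | K1) => PNum q s true ch
  | PNum q false true ch, KComma => PNum q true false ch
  | PNum q true true _, KRp => PQuant (~~ q)
  | _, _ => PErr
  end.

Definition pfinal (p : pstate) : bool :=
  match p with PTarget true | PQuant false => true | _ => false end.

(* The pair (total, current number): the chosen numbers of the universal pairs,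
   or of the existential ones if [m], are subtracted from the total.  The first
   pass ([m] = false) starts the total at [S], the second one resumes it. *)
Definition parith (m : bool) (p : pstate) (d : kgsym) : aff :=
  match p, d with
  | PTarget _, K0 => if m then aff_id else aff_fst 2 0
  | PTarget _, K1 => if m then aff_id else aff_fst 2 1
  | PNum _ _ _ _, K0 => aff_snd 2 0
  | PNum _ _ _ _, K1 => aff_snd 2 1
  | PNum q s _ ch, (KComma | KRp) => aff_proj (if (q == m) && (s == ch) then -1 else 0)
  | _, _ => aff_id
  end.

Definition kgstate : Type := (pstate * (rat * rat))%type.

Definition kgstep (m c : bool) (d : kgsym) (x : kgstate) : kgstate :=
  (pnext c x.1 d, parith m x.1 d x.2).

Fixpoint kgrun (m : bool) (o : seq kgsym) (x y : kgstate) : bool :=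
  if o is d :: o' then kgrun m o' (kgstep m true d x) y || kgrun m o' (kgstep m false d x) y
  else x == y.

Lemma ex_kgrun m o x : exists y, kgrun m o x y.
Proof.
elim: o x => [|d o IHo] x /=; first by exists x.
by have [y run_y] := IHo (kgstep m true d x); exists y; rewrite run_y.
Qed.

Lemma kgrun_consP m d o x y :
  reflect (exists c, kgrun m o (kgstep m c d x) y) (kgrun m (d :: o) x y).
Proof. by apply: (iffP orP) => [[?|?]|[[] ?]]; [exists true|exists false|left|right]. Qed.

Lemma kgrun_cons_const m d o x x' y : (forall c, kgstep m c d x = x') ->
  kgrun m (d :: o) x y = kgrun m o x' y.
Proof. by move=> E; rewrite /= !E orbb. Qed.

Definition bit (b : bool) : kgsym := if b then K1 else K0.

Definition bitfold : nat -> seq bool -> nat := foldl (fun n (b : bool) => (n.*2 + b)%N).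

Lemma natr_double_bit (R : pzSemiRingType) n (b : bool) :
  (n.*2 + b)%N%:R = 2 * n%:R + b%:R :> R.
Proof. by rewrite natrD -mul2n natrM. Qed.

Lemma kgrun_number m a o q s ne ch x n y :
  kgrun m (bits a ++ o) (PNum q s ne ch, (x, n%:R)) y =
  kgrun m o (PNum q s (ne || (a != [::])) ch, (x, (bitfold n a)%:R)) y.
Proof.
elim: a n ne => [|b a IHa] n ne; first by rewrite orbF.
rewrite orbT -[true]/(true || (a != [::])) -IHa; apply: kgrun_cons_const => c.
by rewrite natr_double_bit; case: b; case: s {IHa}; case: ne; rewrite /kgstep aff_sndE.
Qed.

Lemma kgrun_target m a o ne x n y :
  kgrun m (bits a ++ o) (PTarget ne, (if m then x else n%:R, 0)) y =
  kgrun m o (PTarget (ne || (a != [::])), (if m then x else (bitfold n a)%:R, 0)) y.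
Proof.
elim: a n ne => [|b a IHa] n ne; first by rewrite orbF.
rewrite orbT -[true]/(true || (a != [::])) -IHa; apply: kgrun_cons_const => c.
by rewrite natr_double_bit; case: b; case: m {IHa}; case: ne; rewrite /kgstep ?aff_idE ?aff_fstE.
Qed.

Definition block : Type := (seq bool * seq bool * seq bool * seq bool)%type.

Definition wf_block (blk : block) : bool :=
  let: (a, b, e, f) := blk in [&& a != [::], b != [::], e != [::] & f != [::]].

Definition selected (m c : bool) (blk : block) : nat :=
  let: (a, b, e, f) := blk in
  bitval (if m then (if c then f else e) else (if c then b else a)).

Lemma kgrun_pair m q a b o x ch y : a != [::] -> b != [::] ->
  kgrun m (bits a ++ KComma :: bits b ++ KRp :: o) (PNum q false false ch, (x, 0)) y =
  kgrun m o (PQuant (~~ q),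
    (if q == m then x - (bitval (if ch then b else a))%:R else x, 0)) y.
Proof.
move=> a0 b0; rewrite -[X in (x, X)]/(0%:R) kgrun_number a0.
rewrite (@kgrun_cons_const _ _ _ _ (PNum q true false ch,
  (x + (if (q == m) && ~~ ch then -1 else 0) * (bitval a)%:R, 0%:R))); last first.
  by move=> c; rewrite /kgstep aff_projE; case: (ch).
rewrite kgrun_number b0; apply: kgrun_cons_const => c.
rewrite /kgstep aff_projE; congr (_, (_, _)); rewrite -![bitfold 0 _]/(bitval _).
by case: (q == m); case: ch => /=; ring.
Qed.

Lemma kgrun_quantified m q d a b o p x y : a != [::] -> b != [::] ->
  (forall c, kgstep m c d (p, (x, 0)) = (POpen q, (x, 0))) ->
  kgrun m (d :: KLp :: bits a ++ KComma :: bits b ++ KRp :: o) (p, (x, 0)) y =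
  kgrun m o (PQuant (~~ q), (if q == m then x - (bitval b)%:R else x, 0)) y ||
  kgrun m o (PQuant (~~ q), (if q == m then x - (bitval a)%:R else x, 0)) y.
Proof.
by move=> a0 b0 open_d; rewrite (kgrun_cons_const _ _ open_d) /= /kgstep /= aff_idE !kgrun_pair.
Qed.

Lemma enc_block_cat a b e f o : enc_block (a, b, e, f) ++ o =
  KAll :: KLp :: bits a ++ KComma :: bits b ++ KRp ::
  KEx :: KLp :: bits e ++ KComma :: bits f ++ KRp :: o.
Proof. by do ![rewrite /= -catA]. Qed.

Lemma kgrun_block m blk o p x y : pfinal p -> wf_block blk ->
  kgrun m (enc_block blk ++ o) (p, (x, 0)) y =
  kgrun m o (PQuant false, (x - (selected m true blk)%:R, 0)) y ||
  kgrun m o (PQuant false, (x - (selected m false blk)%:R, 0)) y.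
Proof.
case: blk => [[[a b] e] f] fin_p /and4P[a0 b0 e0 f0]; rewrite enc_block_cat.
rewrite (@kgrun_quantified m false) //; last first.
  by move=> c; case: p fin_p => [[]|[]| | |] // _; rewrite /kgstep aff_idE.
rewrite !(@kgrun_quantified m true) //; try by move=> c; rewrite /kgstep aff_idE.
by case: m; rewrite /= ?orbb.
Qed.

Definition selected_sum (m : bool) (cs : seq bool) (blks : seq block) : nat :=
  sumn [seq selected m cblk.1 cblk.2 | cblk <- zip cs blks].

Lemma kgrun_blocksP m blks p x y : pfinal p -> all wf_block blks ->
  reflect (exists2 cs, size cs = size blks &
             y = (if nilp blks then p else PQuant false, (x - (selected_sum m cs blks)%:R, 0)))
          (kgrun m (flatten (map enc_block blks)) (p, (x, 0)) y).
Proof.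
elim: blks p x => [|blk blks IHblks] p x fin_p /=.
  move=> _; apply: (iffP eqP) => [<-|[[|//] _ ->]]; last by rewrite subr0.
  by exists [::]; rewrite ?subr0.
case/andP=> wf_blk wf_blks; rewrite kgrun_block //.
have tailP c := IHblks (PQuant false) (x - (selected m c blk)%:R) isT wf_blks.
have cons_sum c cs : x - (selected_sum m (c :: cs) (blk :: blks))%:R =
    x - (selected m c blk)%:R - (selected_sum m cs blks)%:R.
  by rewrite /selected_sum /= natrD opprD addrA.
apply: (iffP orP) => [|[[//|c cs] [size_cs] Ey]].
  by case=> /tailP[cs size_cs ->]; [exists (true :: cs)|exists (false :: cs)];
    rewrite /= ?size_cs // if_same cons_sum.
suff : kgrun m (flatten (map enc_block blks)) (PQuant false, (x - (selected m c blk)%:R, 0)) y.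
  by case: (c); [left|right].
by apply/tailP; exists cs; rewrite // Ey if_same cons_sum.
Qed.

Lemma kgrun_encP m S blks x y : S != [::] -> all wf_block blks ->
  reflect (exists2 cs, size cs = size blks &
             y = (if nilp blks then PTarget true else PQuant false,
                  ((if m then x else (bitval S)%:R) - (selected_sum m cs blks)%:R, 0)))
          (kgrun m (enc_KG S blks) (PTarget false, (if m then x else 0, 0)) y).
Proof.
move=> S0 wf_blks; rewrite (kgrun_target m S _ false x 0) S0.
exact: kgrun_blocksP.
Qed.

Definition lang : Type := seq kgsym -> Prop.

Definition symbol (d : kgsym) (k : lang) : lang := fun o => exists2 o', o = d :: o' & k o'.

Definition digits (ne : bool) (k : lang) : lang := fun o =>
  exists a o', [/\ o = bits a ++ o', ne || (a != [::]) & k o'].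

Definition blocks : lang := fun o =>
  exists2 blks, all wf_block blks & o = flatten (map enc_block blks).

Definition pair (k : lang) : lang :=
  digits false (symbol KComma (digits false (symbol KRp k))).

Definition after_pair (q : bool) : lang :=
  if q then blocks else symbol KEx (symbol KLp (pair blocks)).

(* The words leading from a parser state to a final one. *)
Definition suffix (p : pstate) : lang :=
  match p with
  | PTarget ne => digits ne blocks
  | PQuant q => after_pair (~~ q)
  | POpen q => symbol KLp (pair (after_pair q))
  | PNum q false ne _ => digits ne (symbol KComma (digits false (symbol KRp (after_pair q))))
  | PNum q true ne _ => digits ne (symbol KRp (after_pair q))
  | PErr => fun=> False
  end.

Lemma digits_bit ne k o b : digits true k o -> digits ne k (bit b :: o).
Proof. by case=> a [o' [-> _ k_o']]; exists (b :: a), o'; rewrite orbT. Qed.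

Lemma digits_end (k : lang) o : k o -> digits true k o.
Proof. by exists [::], o. Qed.

Lemma pair_cat k o : pair k o -> exists a b o',
  [/\ o = bits a ++ KComma :: bits b ++ KRp :: o', a != [::], b != [::] & k o'].
Proof. by case=> a [? [-> a0 [? -> [b [? [-> b0 [o' -> k_o']]]]]]]; exists a, b, o'. Qed.

Lemma blocks_cons o : suffix (POpen false) o -> blocks (KAll :: o).
Proof.
case=> ? -> /pair_cat[a [b [? [-> a0 b0 [? -> [? -> /pair_cat[e [f [? [-> e0 f0]]]]]]]]]].
case=> blks wf_blks ->.
exists ((a, b, e, f) :: blks); first by rewrite /= wf_blks andbT; apply/and4P.
by rewrite -enc_block_cat.
Qed.

Lemma suffix_cons c p d o : suffix (pnext c p d) o -> suffix p (d :: o).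
Proof.
case: p => [[]|[]|q|q [] [] ch|]; case: d => //=; rewrite ?negbK;
  try exact: (@digits_bit _ _ _ false); try exact: (@digits_bit _ _ _ true).
- by move=> /blocks_cons; exact: digits_end.
- by exists o.
- exact: blocks_cons.
- by exists o.
- by move=> suff_o; apply: digits_end; exists o.
- by move=> suff_o; apply: digits_end; exists o.
Qed.

Lemma kgrun_suffix m o x y : kgrun m o x y -> pfinal y.1 -> suffix x.1 o.
Proof.
elim: o x => [|d o IHo] x; last by case/kgrun_consP=> c /IHo suff_o /suff_o /suffix_cons.
move=> /eqP <-; case: x.1 => [[]|[]| | |] // _; last by exists [::].
by apply: digits_end; exists [::].
Qed.

Definition block_values (blk : block) : nat * nat * nat * nat :=
  let: (a, b, e, f) := blk in (bitval a, bitval b, bitval e, bitval f).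

Lemma sum_selected cs ds (blks : seq block) : size cs = size blks -> size ds = size blks ->
  (\sum_(i < size (map block_values blks))
     let: (a, b, e, f) := nth (0, 0, 0, 0) (map block_values blks) i in
     (if nth false cs i then b else a) + (if nth false ds i then f else e))%N =
  (selected_sum false cs blks + selected_sum true ds blks)%N.
Proof.
elim: blks cs ds => [|[[[a b] e] f] blks IHblks] [|c cs] [|d ds] //=; first by rewrite big_ord0.
case=> size_cs [size_ds]; rewrite big_ord_recl /= IHblks //.
by rewrite /selected_sum /=; case: c; case: d; lia.
Qed.

Lemma KG_gameP S (blks : seq block) :
  KG_game S (map block_values blks) <->
  forall cs, size cs = size blks -> exists2 ds, size ds = size blks &
    S%:R - (selected_sum false cs blks)%:R - (selected_sum true ds blks)%:R == 0 :> rat.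
Proof.
have eq_sum0 cs ds : (S%:R - (selected_sum false cs blks)%:R - (selected_sum true ds blks)%:R
    == 0 :> rat) = (S == selected_sum false cs blks + selected_sum true ds blks)%N.
  by rewrite -addrA -opprD -natrD subr_eq0 eqr_nat.
split=> win cs size_cs.
  have [|ds [size_ds sum_S]] := win cs; first by rewrite size_map.
  rewrite size_map in size_ds; exists ds => //; rewrite eq_sum0; apply/eqP.
  by apply: etrans sum_S _; exact: sum_selected.
rewrite size_map in size_cs; have [ds size_ds] := win cs size_cs.
rewrite eq_sum0 => /eqP ->; exists ds; split; first by rewrite size_map.
by apply: esym; exact: sum_selected.
Qed.

Definition second_pass (x : kgstate) : kgstate := (PTarget false, (x.2.1, 0)).

Definition kgwin (x : kgstate) : bool := pfinal x.1 && (x.2.1 == 0).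

Definition kgwon (o : seq kgsym) : Prop := forall x, kgrun false o (PTarget false, (0, 0)) x ->
  exists2 y, kgrun true o (second_pass x) y & kgwin y.

Lemma not_kgwon o : ~ kgwon o -> exists2 x, kgrun false o (PTarget false, (0, 0)) x &
  forall y, kgrun true o (second_pass x) y -> ~~ kgwin y.
Proof.
move=> lost_o; have [x lost_x] := not_all_ex_not _ _ lost_o.
have [run_x lost] := imply_to_and _ _ lost_x; exists x => // y run_y.
by apply/negP=> win_y; apply: lost; exists y.
Qed.

Lemma LKG_kgwon o : LKG o -> kgwon o.
Proof.
case=> S [blks [S0 [wf_blks [-> /KG_gameP win]]]] x.
move/(@kgrun_encP false S blks 0 x S0 wf_blks) => [cs /win[ds size_ds sum0] ->].
eexists; first by apply/(@kgrun_encP true) => //; exists ds.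
by rewrite /kgwin /= sum0 andbT; case: nilp.
Qed.

Lemma kgwon_LKG o : kgwon o -> LKG o.
Proof.
move=> won; have [x run_x] := ex_kgrun false o (PTarget false, (0, 0)).
have [y run_y /andP[fin_y _]] := won x run_x.
have [S [tl [enc_o S0 [blks wf_blks Etl]]]] := kgrun_suffix run_y fin_y.
rewrite {tl}Etl in enc_o; exists S, blks; do 3!split=> //; apply/KG_gameP => cs size_cs.
pose x' : kgstate := (if nilp blks then PTarget true else PQuant false,
  ((bitval S)%:R - (selected_sum false cs blks)%:R, 0)).
have [|z run_z /andP[_ z0]] := won x'.
  by rewrite enc_o; apply/(@kgrun_encP false S blks 0 x' S0 wf_blks); exists cs.
move: run_z; rewrite enc_o => /(@kgrun_encP true S blks _ z S0 wf_blks)[ds size_ds Ez].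
by exists ds => //; rewrite Ez in z0.
Qed.

Definition int_pair (p : rat * rat) : bool := (p.1 \is a Num.int) && (p.2 \is a Num.int).

Lemma int_pair_parith m p d z : int_pair z -> int_pair (parith m p d z).
Proof.
case/andP=> int1 int2; rewrite /int_pair /aff_app.
case: p => [ne|q|q|q s ne ch|]; case: d; case: m => //=; try (case: ifP => _ /=);
  by rewrite ?rpredD ?rpredM ?rpredN ?rpred0 ?rpred1 ?rpred_nat.
Qed.

Lemma int_pair_kgrun m o x y : kgrun m o x y -> int_pair x.2 -> int_pair y.2.
Proof.
elim: o x => [|d o IHo] x; first by move=> /eqP ->.
by case/kgrun_consP=> c /IHo int_y /(int_pair_parith m x.1 d)/int_y.
Qed.

Definition kgopt (m c : bool) (od : option kgsym) (x : kgstate) : kgstate :=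
  if od is Some d then kgstep m c d x else x.

Lemma kgrun_pmapP m od os x y :
  reflect (exists c, kgrun m (pmap id os) (kgopt m c od x) y) (kgrun m (pmap id (od :: os)) x y).
Proof.
case: od => [d|]; first exact: kgrun_consP.
by apply: (iffP idP) => [run_y|[_]] //; exists true.
Qed.

Fixpoint mean (m : bool) (os : seq (option kgsym)) (v : kgstate -> rat) (x : kgstate) : rat :=
  if os is od :: os' then
    (mean m os' v (kgopt m true od x) + mean m os' v (kgopt m false od x)) / 2
  else v x.

Lemma mean_ge m os v x a : (forall y, a <= v y) -> a <= mean m os v x.
Proof.
move=> le_a; elim: os x => [|od os IHos] x //=.
by have := IHos (kgopt m true od x); have := IHos (kgopt m false od x); lra.
Qed.

Lemma mean_le m os v x a : (forall y, v y <= a) -> mean m os v x <= a.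
Proof.
move=> le_a; elim: os x => [|od os IHos] x //=.
by have := IHos (kgopt m true od x); have := IHos (kgopt m false od x); lra.
Qed.

Lemma mean_ge_reached m os v x y a : (forall z, a <= v z) -> kgrun m (pmap id os) x y ->
  a + (v y - a) / 2 ^+ size os <= mean m os v x.
Proof.
move=> le_a; elim: os x => [|od os IHos] x.
  by move=> /eqP ->; rewrite expr0 divr1 addrC subrK.
case/kgrun_pmapP=> c /IHos; have := mean_ge m os (kgopt m (~~ c) od x) le_a.
have -> : a + (v y - a) / 2 ^+ size (od :: os) = (a + (a + (v y - a) / 2 ^+ size os)) / 2.
  by rewrite /= exprS; field; rewrite expf_neq0.
by case: c => /=; lra.
Qed.

(** * Encoding configurations by numbers *)

Definition is_left (S : Type) (s : tsym S) : bool := if s is LEnd then true else false.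
Definition is_right (S : Type) (s : tsym S) : bool := if s is REnd then true else false.

Lemma is_left_tape (S : Type) (w : seq S) i : is_left (tape_at w i) = (i == 0)%N.
Proof. by case: i => //= i; case: drop. Qed.

Lemma is_right_tape (S : Type) (w : seq S) i : is_right (tape_at w i) = (size w < i)%N.
Proof. by case: i => //= i; rewrite ltnS -subn_eq0 -size_drop; case: drop. Qed.

Fixpoint radix (R : pzSemiRingType) (b : R) (f : nat -> R) (k : nat) : R :=
  if k is k'.+1 then b * radix b f k' + f k' else 0.

Lemma natr_radix (R : pzSemiRingType) (b : nat) f k :
  (radix b f k)%:R = radix b%:R (fun i => (f i)%:R) k :> R.
Proof. by elim: k => //= k <-; rewrite natrD natrM. Qed.

Lemma eq_radix (R : pzSemiRingType) (b : R) f g k : (forall i, (i < k)%N -> f i = g i) ->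
  radix b f k = radix b g k.
Proof.
by elim: k => //= k IHk eq_fg; rewrite IHk ?eq_fg // => i /ltnW; exact: eq_fg.
Qed.

Lemma radixD (R : pzSemiRingType) (b : R) f g k :
  radix b (fun i => f i + g i) k = radix b f k + radix b g k.
Proof. by elim: k => [|k IHk] /=; rewrite ?addr0 // IHk mulrDr addrACA. Qed.

Lemma radixZ (R : comPzSemiRingType) (b c : R) f k :
  radix b (fun i => c * f i) k = c * radix b f k.
Proof. by elim: k => [|k IHk] /=; rewrite ?mulr0 // IHk mulrCA -mulrDr. Qed.

Lemma digit_inj b x d x' d' : (d < b)%N -> (d' < b)%N ->
  (b * x + d = b * x' + d')%N -> x = x' /\ d = d'.
Proof.
move=> lt_d lt_d'; rewrite !(mulnC b) => E; have b_gt0 := leq_ltn_trans (leq0n d) lt_d.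
split; first by move: (congr1 (divn^~ b) E); rewrite !divnMDl // !divn_small // !addn0.
by move: (congr1 (modn^~ b) E); rewrite !modnMDl !modn_small.
Qed.

Definition spike (R : pzSemiRingType) (p : nat) (c : R) (i : nat) : R := if i == p then c else 0.

Lemma radix_spike (R : pzSemiRingType) (b : R) p c k :
  radix b (spike p c) k = if (p < k)%N then b ^+ (k.-1 - p) * c else 0.
Proof.
elim: k => //= k ->; rewrite /spike ltnS eq_sym; case: ltngtP => [lt_pk|lt_kp|->].
- by rewrite addr0 mulrA -exprS; congr (_ ^+ _ * _); lia.
- by rewrite mulr0 addr0.
- by rewrite mulr0 add0r subnn expr0 mul1r.
Qed.

Arguments radix : simpl never.

Definition shift (F : fieldType) (b : F) (mv : move) : F :=
  match mv with MLeft => b | MStay => 1 | MRight => b^-1 end.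

Lemma radix_spike_move (F : fieldType) (b : F) mv p c k : b != 0 -> (p < k)%N ->
  (move_work mv p < k)%N -> (mv = MLeft -> 0 < p)%N ->
  radix b (spike p (shift b mv * c)) k = radix b (spike (move_work mv p) c) k.
Proof.
move=> b0; rewrite !radix_spike; case: mv => /= lt_p lt_mv left_p; rewrite lt_p ?lt_mv ?mul1r //.
  have -> : (k.-1 - p.-1 = (k.-1 - p).+1)%N by have := left_p erefl; lia.
  by rewrite exprSr mulrA.
have -> : (k.-1 - p = (k.-1 - p.+1).+1)%N by lia.
by rewrite exprSr -mulrA mulVKf.
Qed.

Definition clip (S : Type) (mi : move) (s : tsym S) : move :=
  match mi with
  | MLeft => if is_left s then MStay else MLeft
  | MStay => MStay
  | MRight => if is_right s then MStay else MRight
  end.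

Lemma move_in_clip (S : Type) (w : seq S) mi p : (p <= (size w).+1)%N ->
  move_in (size w).+1 mi p = move_work (clip mi (tape_at w p)) p.
Proof.
move=> le_p; case: mi; rewrite /= ?is_left_tape ?is_right_tape //; first by case: p {le_p}.
by case: ltnP => lt_p /=; lia.
Qed.

(* The move of the block of [n] cells containing the work head, and its new
   offset in the block, when the cell at offset [j] is left in direction [mw]. *)
Definition carry (n : nat) (mw : move) (leftmost : bool) (j : nat) : move * nat :=
  match mw with
  | MLeft => if (0 < j)%N then (MStay, j.-1) else if leftmost then (MStay, 0%N) else (MLeft, n.-1)
  | MStay => (MStay, j)
  | MRight => if (j.+1 < n)%N then (MStay, j.+1) else (MRight, 0%N)
  end.

Lemma carryP n mw p (mj := carry n mw (p %/ n == 0)%N (p %% n)) : (0 < n)%N ->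
  [/\ (move_work mw p %/ n = move_work mj.1 (p %/ n))%N, (move_work mw p %% n = mj.2)%N
    & mj.1 = MLeft -> (0 < p %/ n)%N].
Proof.
move=> n_gt0; rewrite {}/mj; have := ltn_pmod p n_gt0; have := divn_eq p n.
move: (p %/ n)%N (p %% n)%N => i j -> lt_j {p}.
have divmod i' j' : (j' < n)%N -> ((i' * n + j') %/ n = i')%N /\ ((i' * n + j') %% n = j')%N.
  by move=> lt_j'; rewrite divnMDl // divn_small // addn0 modnMDl modn_small.
case: mw => /=; last 2 first.
- by have [-> ->] := divmod i j lt_j.
- case: ltnP => lt_Sj /=; first by rewrite -addnS; have [-> ->] := divmod i j.+1 lt_Sj.
  have -> : (i * n + j).+1 = (i.+1 * n + 0)%N by lia.
  by have [-> ->] := divmod i.+1 0%N n_gt0.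
case: j lt_j => [|j] lt_j /=; last first.
  by rewrite addnS; have [-> ->] := divmod i j (ltnW lt_j).
case: i => [|i] /=; first by rewrite mul0n div0n mod0n.
have -> : (i.+1 * n + 0).-1 = (i * n + n.-1)%N by lia.
by have [|-> ->] := divmod i n.-1; rewrite ?prednK.
Qed.

Section Letters.
Variables (S : finType) (D : Type) (M : lstm S D).
Local Notation n := (mc M).
Local Notation cells := {ffun 'I_n -> mG M}.
Local Notation ncells := #|{: {ffun 'I_n -> mG M}}|.

(* What the configuration shows at a position of the input tape: the [n] work
   cells stored there, the work head if it is on one of them, and whether the
   input head is there. *)
Definition letter : Type := (cells * option 'I_n * bool)%type.

Definition action : Type := (mQ M * mG M * move * move * option D)%type.

Definition act_state (d : action) : mQ M := d.1.1.1.1.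
Definition act_out (d : action) : option D := d.2.

Definition head_code (o : option 'I_n) : nat := if o is Some j then j.+1 else 0%N.

Definition code (l : letter) : nat :=
  (ncells * (n.+1 * l.2 + head_code l.1.2) + enum_rank l.1.1)%N.

Definition base : nat := (ncells * (n.+1).*2)%N.

Lemma head_code_lt o : (head_code o < n.+1)%N.
Proof. by case: o => [j|] //=; rewrite ltnS ltn_ord. Qed.

Lemma code_lt l : (code l < base)%N.
Proof.
have := ltn_ord (enum_rank l.1.1); have := head_code_lt l.1.2; rewrite /code /base => lt_h lt_r.
apply: (@leq_trans (ncells * (n.+1 * l.2 + head_code l.1.2).+1)).
  by rewrite mulnS addnC ltn_add2r.
by rewrite leq_mul2l; apply/orP; right; case: l.2 lt_h; lia.
Qed.

Lemma code_inj : injective code.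
Proof.
move=> [[bl o] h] [[bl' o'] h'] /(digit_inj (ltn_ord _) (ltn_ord _))[/= + eq_bl].
case/(digit_inj (head_code_lt _) (head_code_lt _)) => eq_h eq_o; congr (_, _, _).
- exact/enum_rank_inj/val_inj.
- by case: o o' eq_o => [j|] [j'|] //= [/val_inj ->].
- by case: h h' eq_h => -[].
Qed.

Definition work_head (p i : nat) : option 'I_n :=
  if (p %/ n == i)%N then insub (p %% n)%N else None.

Definition letter_of (C : tmconf S D M) (i : nat) : letter :=
  ([ffun j : 'I_n => ctape C (n * i + j)], work_head (cwp C) i, cip C == i).

Definition enc (C : tmconf S D M) (k : nat) : nat := radix base (fun i => code (letter_of C i)) k.

Lemma natr_encS C k :
  (enc C k.+1)%:R = base%:R * (enc C k)%:R + (code (letter_of C k))%:R :> rat.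
Proof. by rewrite -natrM -natrD. Qed.

Definition init_letter (s : tsym S) : letter :=
  ([ffun=> mblank M], if is_left s then insub 0%N else None, is_left s).

Lemma letter_of_init w i : letter_of (tm_init S D M) i = init_letter (tape_at w i).
Proof.
rewrite /letter_of /init_letter /work_head /= is_left_tape div0n mod0n ![0%N == i]eq_sym.
by congr (_, _, _).
Qed.

Definition write (bl : cells) (o : option 'I_n) (a : mG M) : cells :=
  if o is Some j then [ffun j' => if j' == j then a else bl j'] else bl.

(* The contribution of the letter [l] at a position showing [s] to the encoding
   of the next configuration; a head leaving for a neighbouring position is
   accounted for by a power of [base]. *)
Definition coef (s : tsym S) (d : action) (l : letter) : rat :=
  let: (_, a, mi, mw, _) := d in
  ncells%:R * (n.+1%:R * (if l.2 then shift base%:R (clip mi s) else 0) +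
               (if l.1.2 is Some j then
                  let: (mv, j') := carry n mw (is_left s) j in shift base%:R mv * j'.+1%:R
                else 0)) +
  (enum_rank (write l.1.1 l.1.2 a))%:R.

Definition scan (w : seq S) (C : tmconf S D M) : action :=
  mdelta M (cq C) (tape_at w (cip C)) (ctape C (cwp C)).

Definition in_bounds (w : seq S) (C : tmconf S D M) : bool :=
  (cip C <= (size w).+1)%N && (cwp C < n * (size w).+1)%N.

Section Step.
Variables (w : seq S) (C : tmconf S D M).
Hypothesis n_gt0 : (0 < n)%N.
Local Notation N := (size w).+2.
Local Notation b := (base%:R : rat).

Lemma base_neq0 : b != 0.
Proof. by rewrite pnatr_eq0 -lt0n; exact: leq_ltn_trans (code_lt (init_letter LEnd)). Qed.

Lemma work_headE p i :
  work_head p i = if (p %/ n)%N == i then Some (Ordinal (ltn_pmod p n_gt0)) else None.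
Proof.
rewrite /work_head; case: eqP => // _; rewrite (insubT (fun j => j < n)%N (ltn_pmod p n_gt0)) /=.
by congr Some; exact: val_inj.
Qed.

Lemma write_letter (a : mG M) i :
  write [ffun j : 'I_n => ctape C (n * i + j)] (work_head (cwp C) i) a =
  [ffun j : 'I_n => if (n * i + j == cwp C)%N then a else ctape C (n * i + j)].
Proof.
rewrite work_headE; apply/ffunP=> j; have cwpE := divn_eq (cwp C) n.
case: eqP => [Ei|ne_i] /=; rewrite !ffunE.
  congr (if _ then _ else _); apply/eqP/eqP => [->|Ej]; first by rewrite /= -Ei mulnC -cwpE.
  by apply: val_inj => /=; rewrite -Ej mulnC modnMDl modn_small.
by case: eqP => // Ej; case: ne_i; rewrite -Ej mulnC divnMDl // divn_small // addn0.
Qed.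

Hypothesis bounds : in_bounds w C.

Lemma radix_input_head mi :
  radix b (fun i => if cip C == i then shift b (clip mi (tape_at w i)) else 0) N =
  radix b (fun i => (move_in (size w).+1 mi (cip C) == i)%:R) N.
Proof.
have /andP[ip_le _] := bounds; pose mv := clip mi (tape_at w (cip C)).
have -> : radix b (fun i => (move_in (size w).+1 mi (cip C) == i)%:R) N =
    radix b (spike (move_work mv (cip C)) 1) N.
  by apply: eq_radix => i _; rewrite move_in_clip // eq_sym /spike; case: eqP.
rewrite -radix_spike_move ?base_neq0 -?move_in_clip //.
- by apply: eq_radix => i _; rewrite eq_sym /spike; case: eqP => [->|//]; rewrite mulr1.
- by rewrite ltnS; case: (mi) => //=; rewrite ?geq_minr // (leq_trans (leq_pred _)).
- by rewrite /mv; case: (mi) => //=; [rewrite is_left_tape; case: (cip C)|case: ifP].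
Qed.

Lemma radix_work_head mw :
  radix b (fun i => if work_head (cwp C) i is Some j then
             let: (mv, j') := carry n mw (is_left (tape_at w i)) j in shift b mv * j'.+1%:R
           else 0) N =
  radix b (fun i => (head_code (work_head (move_work mw (cwp C)) i))%:R) N.
Proof.
have [Ediv Emod left_move] := carryP mw (cwp C) n_gt0.
set mj := carry _ _ _ _ in Ediv Emod left_move.
have lt_p : (cwp C %/ n < (size w).+1)%N by rewrite ltn_divLR // mulnC; case/andP: bounds.
have -> : radix b (fun i => (head_code (work_head (move_work mw (cwp C)) i))%:R) N =
    radix b (spike (move_work mj.1 (cwp C %/ n)) mj.2.+1%:R) N.
  apply: eq_radix => i _; rewrite /spike work_headE Ediv eq_sym.
  by case: eqP => //= _; rewrite Emod.
rewrite -radix_spike_move ?base_neq0 //; first 1 last.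
- exact: ltnW.
- by case: mj.1 => /=; lia.
apply: eq_radix => i _; rewrite /spike work_headE eq_sym; case: eqP => //= ->.
by rewrite is_left_tape -/mj [mj]surjective_pairing.
Qed.

Lemma radix_coef : ~~ mhalt M (cq C) ->
  radix b (fun i => coef (tape_at w i) (scan w C) (letter_of C i)) N =
  (enc (tm_step S D M w C) N)%:R.
Proof.
move=> /negPf run; rewrite natr_radix /tm_step run -/(scan w C).
case: (scan w C) => [[[[q a] mi] mw] od]; rewrite /coef /letter_of /code /=.
rewrite !(radixD, radixZ) radix_input_head radix_work_head -!(radixD, radixZ).
by apply: eq_radix => i _; rewrite write_letter natrD natrM natrD natrM.
Qed.

End Step.

Section Run.
Variable w : seq S.
Local Notation step := (tm_step S D M w).
Implicit Types C : tmconf S D M.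

Lemma cq_tm_step C : ~~ mhalt M (cq C) -> cq (step C) = act_state (scan w C).
Proof. by move=> /negPf run; rewrite /tm_step run -/(scan w C); case: scan => [[[[]]]]. Qed.

Lemma cout_tm_step C : ~~ mhalt M (cq C) ->
  cout (step C) = cout C ++ pmap id [:: act_out (scan w C)].
Proof.
by move=> /negPf run; rewrite /tm_step run -/(scan w C); case: scan => [[[[? ?] ?] ?] []].
Qed.

Lemma tm_step_halted C : mhalt M (cq C) -> step C = C.
Proof. by rewrite /tm_step => ->. Qed.

Lemma cip_tm_run t : (cip (tm_run S D M w t) <= (size w).+1)%N.
Proof.
elim: t => [//|t]; rewrite /tm_run iterS; move: (iter _ _ _) => C le_ip.
rewrite /tm_step; case: ifP => // _; case: mdelta => [[[[q a] mi] mw] od] /=.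
by case: mi; rewrite //= ?geq_minr // (leq_trans (leq_pred _)).
Qed.

Fixpoint halting_run (k : nat) C : bool :=
  in_bounds w C &&
  (if k is k'.+1 then ~~ mhalt M (cq C) && halting_run k' (step C) else mhalt M (cq C)).

Definition outs (k : nat) C : seq (option D) := [seq act_out (scan w C') | C' <- traject step C k].

Lemma size_outs k C : size (outs k C) = k.
Proof. by rewrite size_map size_traject. Qed.

Lemma ex_halting_run t C : (forall s, in_bounds w (iter s step C)) ->
  mhalt M (cq (iter t step C)) ->
  exists2 k, halting_run k C & cout (iter t step C) = cout C ++ pmap id (outs k C).
Proof.
elim: t C => [|t IHt] C bounds halts; first by exists 0%N; rewrite ?cats0 //= (bounds 0%N).
have [halted_C|run] := boolP (mhalt M (cq C)).
  by exists 0%N; rewrite ?cats0 ?iter_fix ?tm_step_halted //= (bounds 0%N).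
rewrite iterSr in halts *; have [|k run_k ->] := IHt (step C) _ halts.
  by move=> s; rewrite -iterSr.
by exists k.+1; rewrite /= ?(bounds 0%N) ?run // cout_tm_step // -catA; case: (act_out _).
Qed.

Lemma linspace_work_gt0 f : computes_linspace S D M f -> (0 < mc M)%N.
Proof. by case/(_ [::]) => _ /(_ 0%N); rewrite muln1. Qed.

Lemma linspace_halting_run f : computes_linspace S D M f ->
  exists2 k, halting_run k (tm_init S D M) & pmap id (outs k (tm_init S D M)) = f w.
Proof.
move=> /(_ w)[[t [halts out_t]] wp_lt].
have [|k run_k out_k] := @ex_halting_run t (tm_init S D M) _ halts.
  by move=> s; rewrite /in_bounds cip_tm_run wp_lt.
by exists k; rewrite // -out_t [RHS]out_k.
Qed.

End Run.
End Letters.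

(** * The verifier *)

Definition tsym_code (S : Type) (s : tsym S) : option (option S) :=
  match s with LEnd => None | REnd => Some None | Sym a => Some (Some a) end.

Definition tsym_decode (S : Type) (u : option (option S)) : tsym S :=
  match u with None => LEnd | Some None => REnd | Some (Some a) => Sym a end.

Lemma tsym_codeK (S : Type) : cancel (@tsym_code S) (@tsym_decode S).
Proof. by case. Qed.

Inductive phase := Start | Load | Rewind | Announce | Toss | Sweep | Scale | Check | Emit
  | Turn | FinalScale | FinalCheck | Lottery | Accept | Reject.

Definition phases : seq phase :=
  [:: Start; Load; Rewind; Announce; Toss; Sweep; Scale; Check; Emit; Turn; FinalScale; FinalCheck;
      Lottery; Accept; Reject].

Definition phase_code (p : phase) : 'I_15 :=
  inord match p with
  | Start => 0 | Load => 1 | Rewind => 2 | Announce => 3 | Toss => 4 | Sweep => 5 | Scale => 6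
  | Check => 7 | Emit => 8 | Turn => 9 | FinalScale => 10 | FinalCheck => 11 | Lottery => 12
  | Accept => 13 | Reject => 14 end%N.

Lemma phase_codeK : cancel phase_code (fun i => nth Reject phases i).
Proof. by case; rewrite /= inordK. Qed.

HB.instance Definition _ := Finite.copy phase (can_type phase_codeK).

(* In a step of parity [p], [Value p] holds the values predicted for the current
   configuration and of the letters received, and [Value (~~ p)] the prediction
   under construction. *)
Inductive register := Value of bool | Total | Stake | Coin.

Definition register_code (k : register) : option (option (option bool)) :=
  match k with
  | Value b => Some (Some (Some b)) | Total => Some (Some None) | Stake => Some None | Coin => None
  end.

Definition register_decode (x : option (option (option bool))) : register :=
  match x with
  | Some (Some (Some b)) => Value b | Some (Some None) => Total | Some None => Stake | None => Coin
  end.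

Lemma register_codeK : cancel register_code register_decode.
Proof. by case. Qed.

HB.instance Definition _ := Finite.copy register (can_type register_codeK).

Definition by_register (T : Type) (p : bool) (current next total stake coin : T)
    (k : register) : T :=
  match k with
  | Value b => if b == p then current else next
  | Total => total
  | Stake => stake
  | Coin => coin
  end.

Section ByRegister.
Variables (T : Type) (p : bool) (cur nxt tot stk coin : T).

Lemma by_register_eta (z : register -> T) :
  by_register p (z (Value p)) (z (Value (~~ p))) (z Total) (z Stake) (z Coin) = z.
Proof. by apply: functional_extensionality => -[b| | |] //; case: b; case: p. Qed.

Lemma by_register_negb :
  by_register (~~ p) cur nxt tot stk coin = by_register p nxt cur tot stk coin.
Proof. by apply: functional_extensionality => -[b| | |] //; case: b; case: p. Qed.

Lemma set_current v : upd _ _ (by_register p cur nxt tot stk coin) (Value p) v =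
  by_register p v nxt tot stk coin.
Proof. by apply: functional_extensionality => -[b| | |] //; case: b; case: p. Qed.

Lemma set_total v : upd _ _ (by_register p cur nxt tot stk coin) Total v =
  by_register p cur nxt v stk coin.
Proof. by apply: functional_extensionality => -[b| | |]. Qed.

Lemma set_coin v : upd _ _ (by_register p cur nxt tot stk coin) Coin v =
  by_register p cur nxt tot stk v.
Proof. by apply: functional_extensionality => -[b| | |]. Qed.

End ByRegister.

Arguments tape_at : simpl never.

Definition idle : register -> aff := fun=> aff_id.

Lemma update_idle z : update idle z = z.
Proof. by apply: functional_extensionality => k; exact: aff_idE. Qed.

Lemma update_by_register p f1 f2 f3 f4 f5 v1 v2 v3 v4 v5 :
  update (by_register p f1 f2 f3 f4 f5) (by_register p v1 v2 v3 v4 v5) =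
  by_register p (f1 v1) (f2 v2) (f3 v3) (f4 v4) (f5 v5).
Proof. by apply: functional_extensionality => -[b| | |] //=; rewrite /update /=; case: eqP. Qed.

Section Protocol.
Variables (S : finType) (M : lstm S kgsym) (eps : rat).

Local Notation b := ((base M)%:R : rat).
Local Notation on_values p f1 f2 := (by_register p f1 f2 aff_id aff_id aff_id).

(* Pass, parity of the step, state of the machine and of the parser. *)
Definition frame : Type := (bool * bool * mQ M * pstate)%type.

(* The symbols announced to be under the two heads, and the choice made if the
   parser opens a pair. *)
Definition claim : Type := (option (option S) * mG M * bool)%type.

Definition ctl : finType := (phase * frame * claim)%type.

Definition msg : finType := (claim * letter M)%type.

Definition agrees (s : tsym S) (u : option (option S)) (a : mG M) (l : letter M) : bool :=
  (l.2 ==> (tsym_code s == u)) && (if l.1.2 is Some j then l.1.1 j == a else true).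

Definition sweep_right (s : tsym S) (f : register -> aff) (more done : ctl) : instr ctl register :=
  if is_right s then Update f done MStay else Update f more MRight.

Definition prog (x : ctl) (s : tsym S) (g : msg) : instr ctl register :=
  let: (ph, fr, cl) := x in
  let: (m, p, q, y) := fr in
  let: (u, a, c) := cl in
  let d := mdelta M q (tsym_decode u) a in
  let goto f ph := Update f (ph, fr, cl) MStay in
  match ph with
  | Start =>
      Update (by_register false (aff_const (0, 0)) (aff_const (0, 0)) (aff_const (0, 0))
                (aff_const (spread (2 / eps))) aff_id)
        (Load, (false, false, mq0 M, PTarget false), cl) MStay
  | Load =>
      sweep_right s (on_values p (aff_fst b (code (init_letter M s))%:R) aff_id)
        (Load, fr, cl) (Rewind, fr, cl)
  | Rewind => if is_left s then goto idle Announce else Update idle (Rewind, fr, cl) MLeft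
  | Announce =>
      if mhalt M q then goto idle (if m then FinalScale else Turn)
      else Update (by_register p aff_id aff_id aff_id (aff_scale 2) (aff_const (1 / 2, 0)))
             (Toss, fr, g.1) MStay
  | Toss => Weigh Coin (Sweep, fr, (u, a, if m then c else true))
                       (Sweep, fr, (u, a, if m then c else false))
  | Sweep =>
      if agrees s u a g.2 then
        sweep_right s (on_values p (aff_snd b (code g.2)%:R) (aff_fst b (coef s d g.2)))
          (Sweep, fr, cl) (Scale, fr, cl)
      else goto idle Reject
  | Scale => goto (on_values p (aff_test eps^-1 (- eps^-1)) aff_id) Check
  | Check => Weigh (Value p) (Emit, fr, cl) (Reject, fr, cl)
  | Emit =>
      Update (by_register p (aff_const (0, 0)) aff_id
                (if act_out d is Some e then parith m y e else aff_id) aff_id aff_id)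
        (Rewind, (m, ~~ p, act_state d, if act_out d is Some e then pnext c y e else y), cl) MStay
  | Turn =>
      Update (by_register false (aff_const (0, 0)) (aff_const (0, 0)) (aff_proj 0) aff_id aff_id)
        (Load, (true, false, mq0 M, PTarget false), cl) MStay
  | FinalScale =>
      if pfinal y then
        goto (by_register p aff_id aff_id (aff_test eps^-1 0) aff_id aff_id) FinalCheck
      else goto idle Reject
  | FinalCheck => Weigh Total (Lottery, fr, cl) (Reject, fr, cl)
  | Lottery => Weigh Stake (Accept, fr, cl) (Start, fr, cl)
  | Accept | Reject => goto idle ph
  end.

Definition phase_of (x : ctl) : phase := x.1.1.

Definition is_accepting (x : ctl) : bool := if phase_of x is Accept then true else false.
Definition is_rejecting (x : ctl) : bool := if phase_of x is Reject then true else false.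

Definition blank_claim : claim := (None, mblank M, false).
Definition blank_msg : msg := (blank_claim, init_letter M REnd).

Definition init_ctl : ctl := (Start, (false, false, mq0 M, PTarget false), blank_claim).

Definition protocol : verifier S := prog_verifier init_ctl is_accepting is_rejecting prog.

Lemma wf_protocol : wf_verifier S protocol.
Proof. by apply: wf_prog_verifier => -[[[]]]. Qed.

Hypothesis work_gt0 : (0 < mc M)%N.
Hypothesis eps_gt0 : 0 < eps.

Variable w : seq S.

Local Notation end_pos := (size w).+1.
Local Notation N := end_pos.+1.
Local Notation tconf := (tmconf S kgsym M).
Local Notation tm0 := (tm_init S kgsym M).
Local Notation tm_step := (tm_step S kgsym M w).
Local Notation scan := (@scan S kgsym M w).
Local Notation game := (prog_game init_ctl is_accepting is_rejecting prog w).
Local Notation caught := (1 - eps / 2).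

Lemma caught_le1 : caught <= 1.
Proof. by move: eps_gt0; lra. Qed.

Lemma forced_reject v fr cl i z : v <= 1 -> forced v (Conf (Reject, fr, cl) i z : position game).
Proof. exact: forced_rejecting. Qed.

Lemma closed_caught : honest_closed caught (@forced _ game caught).
Proof. exact: honest_closed_forced. Qed.

Implicit Types (W : position game -> Prop) (m p : bool) (fr : frame) (cl : claim).

(* Where a sweep over the input tape is after [i] positions. *)
Definition sweep_position (more done : ctl) (i : nat) z : position game :=
  if (i <= end_pos)%N then Conf more i z else Conf done end_pos z.

Lemma advances_sweep_right W q i z g f more done : (i <= end_pos)%N ->
  instr_at prog w (Conf q i z) g = sweep_right (tape_at w i) f more done ->
  W (sweep_position more done i.+1 (update f z)) -> advances W (Conf q i z) g.
Proof.
rewrite /sweep_right /sweep_position is_right_tape ltnS => le_i.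
case: ltnP => [lt_wi|le_iw] E Wz; apply: advances_update E _ => /=; last by rewrite (minn_idPl _).
by rewrite [X in Conf _ X _](_ : i = end_pos) //; lia.
Qed.

Definition true_claim (C : tconf) (c : bool) : claim :=
  (tsym_code (tape_at w (cip C)), ctape C (cwp C), c).

Definition announcing m p (C : tconf) (x : kgstate) (A : rat) cl coin : position game :=
  Conf (Announce, (m, p, cq C, x.1), cl) 0
    (by_register p ((enc C N)%:R, 0) (0, 0) x.2 (spread A) coin).

(* The coin about to be tossed decides the choice in the first pass only. *)
Definition tossing m p (C : tconf) (x : kgstate) (A : rat) cl : position game :=
  Conf (Toss, (m, p, cq C, x.1), cl) 0
    (by_register p ((enc C N)%:R, 0) (0, 0) x.2 (spread (2 * A)) (1 / 2, 0)).

Definition sweeping fr cl (i : nat) z : position game :=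
  sweep_position (Sweep, fr, cl) (Scale, fr, cl) i z.

Definition ready W m p C x A : Prop := forall cl coin, W (announcing m p C x A cl coin).

Lemma advances_announce W m p C x A cl coin g : ~~ mhalt M (cq C) ->
  W (tossing m p C x A g.1) -> advances W (announcing m p C x A cl coin) g.
Proof.
case: cl => [[u a] c] run Wtoss; apply: advances_update; first by rewrite /instr_at /= (negPf run).
by rewrite update_by_register !aff_idE aff_scale_spread aff_constE.
Qed.
Definition prediction (C : tconf) (i : nat) : rat :=
  radix b (fun j => coef (tape_at w j) (scan C) (letter_of C j)) i.

Lemma prediction_all C : in_bounds w C -> ~~ mhalt M (cq C) ->
  prediction C N = (enc (tm_step C) N)%:R.
Proof. exact: radix_coef. Qed.

(* The claim is false about a symbol that has yet to be met after [i] positions. *)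
Definition misread (C : tconf) (u : option (option S)) (a : mG M) (i : nat) : bool :=
  (i <= cip C)%N && (u != tsym_code (tape_at w (cip C))) ||
  (i <= cwp C %/ mc M)%N && (a != ctape C (cwp C)).

Lemma agrees_letter C i :
  agrees (tape_at w i) (tsym_code (tape_at w (cip C))) (ctape C (cwp C)) (letter_of C i).
Proof.
apply/andP; split=> /=; first by apply/implyP=> /eqP ->.
by rewrite (work_headE work_gt0); case: eqP => // <-; rewrite ffunE /= mulnC -divn_eq.
Qed.

Lemma misreadS C u a i : agrees (tape_at w i) u a (letter_of C i) ->
  misread C u a i -> misread C u a i.+1.
Proof.
case/andP=> /= agree_u agree_a /orP[] /andP[]; rewrite leq_eqVlt => /predU1P[Ei|lt_i] false_claim.
- by case/negP: false_claim; rewrite eq_sym -Ei; apply: (implyP agree_u); rewrite Ei.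
- by rewrite /misread lt_i false_claim.
- case/negP: false_claim; move: agree_a; rewrite (work_headE work_gt0) -Ei eqxx ffunE /= Ei.
  by rewrite mulnC -divn_eq eq_sym.
- by rewrite /misread lt_i false_claim orbT.
Qed.

Lemma misread_all C u a : in_bounds w C -> misread C u a N = false.
Proof.
case/andP=> ip_le wp_lt; apply/negbTE/negP=> /orP[] /andP[]; first by rewrite ltnNge ip_le.
by move=> + _; rewrite ltnNge -ltnS (leq_trans _ (leqnSn _)) // ltn_divLR // mulnC.
Qed.

Lemma enc_letter_inj (C : tconf) k (l : letter M) i :
  (base M * k + code l)%N = enc C i.+1 -> k = enc C i /\ l = letter_of C i.
Proof. by case/(digit_inj (code_lt _) (code_lt _)) => -> /code_inj ->. Qed.

Lemma caught_test (c : position game) k x yes no : ~~ halted c ->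
  (forall g, instr_at prog w c g = Weigh k yes no) -> is_rejecting no ->
  rg c k = spread (eps^-1 * x) -> 1 <= `|x| -> forced caught c.
Proof.
move=> run E rej_no Ek x_ge1; apply: (forced_weigh (vyes := 0) (vno := 1)) run E _ _ _ => [z|z|].
- exact: forced0.
- exact: forced_rejecting.
by rewrite Ek; have := prob_last_spread_le eps_gt0 x_ge1; lra.
Qed.

Lemma caught_scale m p q y cl i h k nxt tot stk coin : h != k ->
  forced caught (Conf (Scale, (m, p, q, y), cl) i
    (by_register p (h%:R, k%:R) nxt tot stk coin) : position game).
Proof.
case: cl => [[u a] c] ne_hk; apply: (closed_update blank_msg closed_caught) => //.
rewrite update_by_register !aff_idE aff_testE mulNr -mulrBr.
by apply: caught_test (natr_dist_ge1 rat ne_hk); rewrite //= eqxx.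
Qed.

Lemma advances_sweep W m p q y u a c i v r nxt tot stk coin cl l
    (fr := (m, p, q, y)) (cl' := (u, a, c)) : (i <= end_pos)%N ->
  (agrees (tape_at w i) u a l -> W (sweeping fr cl' i.+1
     (by_register p (v, b * r + (code l)%:R)
        (aff_fst b (coef (tape_at w i) (mdelta M q (tsym_decode u) a) l) nxt) tot stk coin))) ->
  (~~ agrees (tape_at w i) u a l -> forall z, W (Conf (Reject, fr, cl') i z)) ->
  advances W (Conf (Sweep, fr, cl') i (by_register p (v, r) nxt tot stk coin)) (cl, l).
Proof.
move=> le_i Wsweep Wreject; case agr: (agrees (tape_at w i) u a l).
  apply: advances_sweep_right; rewrite // /instr_at /= ?agr //.
  by rewrite update_by_register !aff_idE aff_sndE; exact: Wsweep.
by apply: advances_update; rewrite /instr_at /= ?agr // update_idle; apply: Wreject; rewrite agr.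
Qed.

Lemma caught_sweep m p q y u a c C : in_bounds w C -> forall i, (i <= N)%N ->
  forall k nxt tot stk coin, (k != enc C i) || misread C u a i ->
  forced caught (sweeping (m, p, q, y) (u, a, c) i
    (by_register p ((enc C N)%:R, k%:R) nxt tot stk coin)).
Proof.
move=> bounds; apply: descending_ind => [|i lt_iN IHi] k nxt tot stk coin wrong.
  rewrite /sweeping /sweep_position ltnn; apply: caught_scale; rewrite eq_sym.
  by move: wrong; rewrite misread_all ?orbF.
rewrite /sweeping /sweep_position -ltnS lt_iN; apply: forced_all => // -[cl l].
apply: advances_sweep => // [agr|_ z]; last exact/forced_reject/caught_le1.
rewrite -natrM -natrD; apply: IHi; move: wrong.
have [/enc_letter_inj[-> El]|//] := eqVneq (base M * k + code l)%N (enc C i.+1).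
by rewrite eqxx => /misreadS; apply; rewrite -El.
Qed.

Lemma caught_toss m p C x A u a c : in_bounds w C ->
  (u != tsym_code (tape_at w (cip C))) || (a != ctape C (cwp C)) ->
  forced caught (tossing m p C x A (u, a, c)).
Proof.
move=> bounds false_claim.
have swept c' z : forced caught (sweeping (m, p, cq C, x.1) (u, a, c') 0
    (by_register p ((enc C N)%:R, 0%:R) (0, 0) x.2 (spread (2 * A)) z)).
  by apply: caught_sweep => //; rewrite eqxx.
apply: (closed_weigh blank_msg closed_caught) => // [|_] z; rewrite set_coin; exact: swept.
Qed.

Section Closed.
Variable W : position game -> Prop.
Hypothesis closedW : honest_closed caught W.

Local Notation by_update := (closed_update blank_msg closedW).
Local Notation by_weigh := (closed_weigh blank_msg closedW).

Lemma closed_rewind fr cl i z :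
  W (Conf (Announce, fr, cl) 0 z) -> W (Conf (Rewind, fr, cl) i z).
Proof.
case: fr cl => [[[m p] q] y] [[u a] c] Wz.
elim: i => [|i IHi]; first by apply: by_update => //; rewrite update_idle.
apply: by_update => // [g|]; first by rewrite /instr_at /= is_left_tape.
by rewrite update_idle.
Qed.

Lemma closed_load m p y cl nxt tot stk coin :
  W (Conf (Announce, (m, p, mq0 M, y), cl) 0
       (by_register p ((enc tm0 N)%:R, 0) nxt tot stk coin)) ->
  W (Conf (Load, (m, p, mq0 M, y), cl) 0 (by_register p (0, 0) nxt tot stk coin)).
Proof.
case: cl => [[u a] c] Wz; pose ctl_at ph : ctl := (ph, (m, p, mq0 M, y), (u, a, c)).
suff : forall i, (i <= N)%N -> W (sweep_position (ctl_at Load) (ctl_at Rewind) i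
    (by_register p ((enc tm0 i)%:R, 0) nxt tot stk coin)) by move/(_ 0%N isT).
apply: descending_ind => [|i lt_iN Wi]; rewrite /sweep_position.
  by rewrite ltnn; exact: closed_rewind.
rewrite -ltnS lt_iN; apply: (closed_advances blank_msg closedW) => // g.
apply: advances_sweep_right; rewrite // ?update_by_register.
by rewrite !aff_idE aff_fstE -letter_of_init -natr_encS.
Qed.

Lemma closed_start fr cl z : ready W false false tm0 (PTarget false, (0, 0)) (2 / eps) ->
  W (Conf (Start, fr, cl) 0 z).
Proof.
case: fr cl => [[[m p] q] y] [[u a] c] Wready; apply: by_update => //.
rewrite -[z](by_register_eta false) update_by_register !aff_constE aff_idE.
exact/closed_load/Wready.
Qed.

Lemma closed_turn p C x A : mhalt M (cq C) -> ready W true false tm0 (second_pass x) A ->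
  ready W false p C x A.
Proof.
case: x => y [t r] halted_C Wready [[u a] c] coin.
apply: by_update => // [g|]; first by rewrite /instr_at /= halted_C.
rewrite update_idle; apply: by_update => //=.
rewrite -[by_register p _ _ _ _ _](by_register_eta false) update_by_register !aff_constE !aff_idE.
rewrite aff_projE mul0r addr0; exact/closed_load/Wready.
Qed.

Lemma closed_scale m p q y cl i v nxt tot stk coin :
  (forall cur, W (Conf (Emit, (m, p, q, y), cl) i (by_register p cur nxt tot stk coin))) ->
  W (Conf (Scale, (m, p, q, y), cl) i (by_register p (v, v) nxt tot stk coin)).
Proof.
case: cl => [[u a] c] Wemit; apply: by_update => //.
rewrite update_by_register !aff_idE aff_testE mulNr subrr.
apply: by_weigh => //= [cur|]; first by rewrite set_current.
by rewrite eqxx prob_last_spread0 ltxx.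
Qed.

Lemma closed_emit m p C x c A i cur coin : ~~ mhalt M (cq C) ->
  ready W m (~~ p) (tm_step C) (kgopt m c (act_out (scan C)) x) A ->
  W (Conf (Emit, (m, p, cq C, x.1), true_claim C c) i
       (by_register p cur ((enc (tm_step C) N)%:R, 0) x.2 (spread A) coin)).
Proof.
move=> run Wready; apply: by_update => //.
rewrite tsym_codeK -/(scan C) update_by_register aff_constE !aff_idE.
apply: closed_rewind; move: (Wready (true_claim C c) coin).
by rewrite /announcing cq_tm_step // by_register_negb; case: (act_out _) => //=; rewrite aff_idE.
Qed.

Lemma closed_sweep m p C x c A coin (fr := (m, p, cq C, x.1)) : in_bounds w C ->
  ~~ mhalt M (cq C) ->
  ready W m (~~ p) (tm_step C) (kgopt m c (act_out (scan C)) x) A ->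
  W (Conf (Sweep, fr, true_claim C c) 0
       (by_register p ((enc C N)%:R, 0) (0, 0) x.2 (spread A) coin)).
Proof.
move=> bounds run Wready; suff : forall i, (i <= N)%N -> W (sweeping fr (true_claim C c) i
    (by_register p ((enc C N)%:R, (enc C i)%:R) (prediction C i, 0) x.2 (spread A) coin))
  by move/(_ 0%N isT).
apply: descending_ind => [|i lt_iN Wi]; rewrite /sweeping /sweep_position.
  by rewrite ltnn prediction_all //; apply: closed_scale => cur; exact: closed_emit.
rewrite -ltnS lt_iN; have adv_true cl : advances W (Conf (Sweep, fr, true_claim C c) i
    (by_register p ((enc C N)%:R, (enc C i)%:R) (prediction C i, 0) x.2 (spread A) coin))
    (cl, letter_of C i).
  apply: advances_sweep; rewrite ?agrees_letter // => _.
  by rewrite tsym_codeK aff_fstE -natr_encS; exact: Wi.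
apply: closedW => // [|[cl l]]; first by exists (blank_claim, letter_of C i).
have [->|ne_l] := eqVneq l (letter_of C i); [left; exact: adv_true|right].
apply: advances_sweep => // [_|_ z]; last exact/forced_reject/caught_le1.
rewrite -natrM -natrD; apply: caught_sweep => //; apply/orP; left.
by apply: contra_neq ne_l => /enc_letter_inj[].
Qed.

Lemma closed_announce m p C x A : in_bounds w C -> ~~ mhalt M (cq C) ->
  (forall c, W (tossing m p C x A (true_claim C c))) -> ready W m p C x A.
Proof.
move=> bounds run Wtoss cl coin; apply: closedW => // [|[[[u a] c] l]].
  by exists (true_claim C false, init_letter M REnd); apply: advances_announce => //; exact: Wtoss.
have [/andP[/eqP -> /eqP ->]|] :=
  boolP ((u == tsym_code (tape_at w (cip C))) && (a == ctape C (cwp C))).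
  by left; apply: advances_announce => //; exact: Wtoss.
by rewrite negb_and => false_claim; right; apply: advances_announce => //; exact: caught_toss.
Qed.

Lemma closed_toss m p C x A c : in_bounds w C -> ~~ mhalt M (cq C) ->
  (forall c', ready W m (~~ p) (tm_step C)
                (kgopt m (if m then c else c') (act_out (scan C)) x) (2 * A)) ->
  W (tossing m p C x A (true_claim C c)).
Proof.
move=> bounds run Wready; apply: by_weigh => // [|_] z; rewrite set_coin.
  exact: closed_sweep (Wready true).
exact: closed_sweep (Wready false).
Qed.

Lemma closed_pass m k p C x A : halting_run w k C ->
  (forall p' C' y, mhalt M (cq C') -> kgrun m (pmap id (outs w k C)) x y ->
     ready W m p' C' y (2 ^+ k * A)) ->
  ready W m p C x A.
Proof.
elim: k p C x A => [|k IHk] p C x A /andP[bounds].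
  by move=> halted_C Wready; rewrite -[A]mul1r; apply: Wready => /=.
case/andP=> run run_k Wready; apply: closed_announce => // c; apply: closed_toss => // c'.
apply: (IHk _ _ _ _ run_k) => p' C' y halted_C' run_y; rewrite mulrA -exprSr.
by apply: Wready => //; apply/kgrun_pmapP; exists (if m then c else c').
Qed.

Lemma closed_verdict p C x A : mhalt M (cq C) ->
  (pfinal x.1 -> forall cl cur nxt coin, W (Conf (FinalCheck, (true, p, cq C, x.1), cl) 0
     (by_register p cur nxt (spread (eps^-1 * x.2.1)) (spread A) coin))) ->
  (~~ pfinal x.1 -> forall fr cl z, W (Conf (Reject, fr, cl) 0 z)) ->
  ready W true p C x A.
Proof.
case: x => y [t r] halted_C /= Wcheck Wreject [[u a] c] coin.
apply: by_update => // [g|]; first by rewrite /instr_at /= halted_C.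
rewrite update_idle; case final_y: (pfinal y).
  apply: by_update => //= [g|]; first by rewrite /instr_at /= final_y.
  by rewrite update_by_register !aff_idE aff_testE mul0r addr0; exact: Wcheck.
apply: by_update => //= [g|]; first by rewrite /instr_at /= final_y.
by apply: Wreject; rewrite final_y.
Qed.

End Closed.

Lemma forced_toss p C x A c (v : bool -> rat) : in_bounds w C -> ~~ mhalt M (cq C) ->
  (forall c, v c <= caught) ->
  (forall c, ready (forced (v c)) false (~~ p) (tm_step C)
               (kgopt false c (act_out (scan C)) x) (2 * A)) ->
  forced ((v true + v false) / 2) (tossing false p C x A (true_claim C c)).
Proof.
move=> bounds run le_v Fready.
have closed_v c' := honest_closed_forced (G := game) (le_v c').
apply: (forced_weigh (vyes := v true) (vno := v false)) => //= [z|z|]; rewrite ?set_coin.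
- exact: closed_sweep (Fready true).
- exact: closed_sweep (Fready false).
by rewrite prob_last_half; lra.
Qed.

Lemma forced_pass_mean k p C x A (v : kgstate -> rat) : (forall y, v y <= caught) ->
  halting_run w k C ->
  (forall p' C' y, mhalt M (cq C') -> kgrun false (pmap id (outs w k C)) x y ->
     ready (forced (v y)) false p' C' y (2 ^+ k * A)) ->
  ready (forced (mean false (outs w k C) v x)) false p C x A.
Proof.
move=> le_v; elim: k p C x A => [|k IHk] p C x A /andP[bounds].
  by move=> halted_C Fready; rewrite -[A]mul1r; apply: Fready => /=.
case/andP=> run run_k Fready; apply: closed_announce => // [|c].
  by apply: honest_closed_forced; exact: mean_le.
apply: (forced_toss _ (v := fun c' => mean false (outs w k (tm_step C)) v
  (kgopt false c' (act_out (scan C)) x))) => // [c'|c']; first exact: mean_le.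
apply: IHk => // p' C' y halted_C' run_y; rewrite mulrA -exprSr.
by apply: Fready => //; apply/kgrun_pmapP; exists c'.
Qed.

(* The value reached by the stake at the end of a round in which each of the two
   passes makes [T] steps: a round is won with a probability of order [eps / 4 ^ T]. *)
Definition prize (T : nat) : rat := 2 ^+ T * (2 ^+ T * (2 / eps)).

Lemma prize_gt0 T : 0 < prize T.
Proof. by rewrite !mulr_gt0 ?exprn_gt0 ?invr_gt0. Qed.

Lemma prob_last_prize T : prob_last (spread (prize T)) <= eps / 4 / 2 ^+ T.
Proof.
have pow_gt0 : 0 < 2 ^+ T :> rat by rewrite exprn_gt0.
rewrite prob_last_spread (gtr0_norm (prize_gt0 T)) -[leRHS]invrK.
rewrite lef_pV2 ?posrE ?invr_gt0 ?divr_gt0 //.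
  have -> : (eps / 4 / 2 ^+ T)^-1 = 2 * (2 ^+ T * (2 / eps)) by field; rewrite !gt_eqF.
  have : 2 ^+ T * (2 / eps) <= prize T.
    by rewrite /prize ler_peMl ?exprn_ege1 // !mulr_ge0 ?invr_ge0 ?ltW.
  by lra.
by have := prize_gt0 T; lra.
Qed.

Definition forced_start (v : rat) : Prop := forall fr cl z,
  forced v (Conf (Start, fr, cl) 0 z : position game).

Lemma forced_verdict v p C x A : mhalt M (cq C) -> forced_start v -> 0 <= v <= caught ->
  ready (forced ((1 - prob_last (spread A)) * v)) true p C x A.
Proof.
move=> halted_C Fstart /andP[v_ge0 le_v]; set q := prob_last _; have lt1 := caught_le1.
have le_qv : (1 - q) * v <= v by rewrite ler_piMl // gerBl prob_last_ge0.
have le_qv1 : (1 - q) * v <= 1 by lra.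
apply: closed_verdict (halted_C) _ _; last by move=> *; exact: forced_reject.
  exact/honest_closed_forced/(le_trans le_qv).
move=> _ [[u a] c] cur nxt coin.
apply: (forced_weigh (vyes := (1 - q) * v) (vno := 1)) => // [z|z|].
- rewrite set_total; apply: (forced_weigh (vyes := 0) (vno := v)) => [|//|z'|z'|].
  + by [].
  + exact: forced0.
  + exact: Fstart.
  + by rewrite mulr0 add0r.
- exact: forced_reject.
rewrite /=; have := prob_last_ge0 (spread (eps^-1 * x.2.1)).
by have := prob_last_le1 (spread (eps^-1 * x.2.1)); nra.
Qed.

Lemma caught_verdict p C x A : mhalt M (cq C) -> x.2.1 \is a Num.int -> ~~ kgwin x ->
  ready (forced caught) true p C x A.
Proof.
move=> halted_C int_x lost; apply: (closed_verdict closed_caught halted_C); last first.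
  by move=> _ fr cl z; exact/forced_reject/caught_le1.
move=> final_x [[u a] c] cur nxt coin; move: lost; rewrite /kgwin final_x /= => x_neq0.
exact: caught_test (norm_intr_ge1 int_x x_neq0).
Qed.

Lemma round_gain (v r q : rat) : 0 <= v < 1 - eps -> 0 <= r -> 0 <= q <= eps / 4 * r ->
  v + eps / 4 * r <= (1 - q) * v + (caught - (1 - q) * v) * r.
Proof.
move: eps_gt0 => eps_pos /andP[v_ge0 lt_v] r_ge0 /andP[q_ge0 le_q].
have le_qv : q * v <= q by rewrite ler_piMr //; lra.
have qv_ge0 : 0 <= q * v by rewrite mulr_ge0.
have : eps / 2 * r <= (caught - (1 - q) * v) * r by rewrite ler_wpM2r //; lra.
by lra.
Qed.

Section Rounds.
Variable T : nat.
Hypothesis halts : halting_run w T tm0.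
Local Notation output := (pmap id (outs w T tm0)).

Lemma forced_second_pass v p C x : v <= caught -> mhalt M (cq C) ->
  (forall p' C' y, mhalt M (cq C') -> kgrun true output (second_pass x) y ->
     ready (forced v) true p' C' y (prize T)) ->
  ready (forced v) false p C x (2 ^+ T * (2 / eps)).
Proof.
move=> le_v halted_C Ffinal; have closed_v := honest_closed_forced (G := game) le_v.
by apply: closed_turn => //; apply: closed_pass halts _.
Qed.

Lemma forced_round v : ~ kgwon output -> forced_start v -> 0 <= v < 1 - eps ->
  forced_start (v + eps / 4 / 2 ^+ T).
Proof.
move=> /not_kgwon[x run_x lost] Fstart v_bounds fr cl z; have eps_pos := eps_gt0.
have /andP[v_ge0 lt_v] := v_bounds; set q := prob_last (spread (prize T)).
have q_ge0 : 0 <= q := prob_last_ge0 _.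
have le_vq : (1 - q) * v <= caught by have := mulr_ge0 q_ge0 v_ge0; lra.
pose value y := if y == x then caught else (1 - q) * v.
have le_value y : value y <= caught by rewrite /value; case: ifP.
have ge_value y : (1 - q) * v <= value y by rewrite /value; case: ifP.
have le_mean : v + eps / 4 / 2 ^+ T <= mean false (outs w T tm0) value (PTarget false, (0, 0)).
  apply: le_trans (mean_ge_reached ge_value run_x).
  rewrite {1}/value eqxx size_outs; apply: round_gain => //; first by rewrite invr_ge0 exprn_ge0.
  by rewrite q_ge0 prob_last_prize.
apply: forced_le le_mean _; apply: closed_start; first exact/honest_closed_forced/mean_le.
apply: forced_pass_mean halts _ => // p C y halted_C run_y.
apply: forced_second_pass => // p' C' y' halted_C' run_y'.
rewrite /value; case: eqP => [Ey|_]; last by apply: forced_verdict; rewrite ?v_ge0 //; lra.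
rewrite Ey in run_y'; apply: caught_verdict => //; last exact: lost.
have /andP[int_x _] : int_pair x.2 by exact: int_pair_kgrun run_x _.
by have /andP[] : int_pair y'.2 by apply: int_pair_kgrun run_y' _; rewrite /int_pair int_x.
Qed.

Lemma protocol_sound : ~ kgwon output ->
  forall P, halt_prob_ge S protocol w P is_rejecting (1 - eps).
Proof.
move=> lost; apply: forced_verifier.
have [v le_v Fstart] : exists2 v, 1 - eps <= v & forced_start v.
  apply: (archi_climb (start := 0) (gain := eps / 4 / 2 ^+ T)).
  - by rewrite !divr_gt0 ?exprn_gt0.
  - by move=> fr cl z; exact: forced0.
  - by move=> v Fstart v_ge0 lt_v; apply: forced_round; rewrite ?v_ge0.
by apply: forced_le le_v _; exact: Fstart.
Qed.

Definition at_lottery (c : position game) : Prop :=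
  [/\ phase_of (st c) = Lottery, hd c = 0%N & rg c Stake = spread (prize T)].

Local Notation safe := (@safe _ game at_lottery).

Lemma safe_closed : honest_closed caught safe.
Proof. exact: honest_closed_safe. Qed.

Lemma safe_verdict p C x : mhalt M (cq C) -> kgwin x -> ready safe true p C x (prize T).
Proof.
move=> halted_C /andP[final_x /eqP x_eq0].
apply: (closed_verdict safe_closed halted_C); last by rewrite final_x.
move=> _ [[u a] c] cur nxt coin.
apply: (closed_weigh blank_msg safe_closed) => //= [z|].
  by apply: safe_checkpoint; rewrite set_total.
by rewrite x_eq0 mulr0 prob_last_spread0 ltxx.
Qed.

Lemma safe_pass k p C x y A : halting_run w k C -> kgrun true (pmap id (outs w k C)) x y ->
  (forall p' C', mhalt M (cq C') -> ready safe true p' C' y (2 ^+ k * A)) ->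
  ready safe true p C x A.
Proof.
elim: k p C x A => [|k IHk] p C x A /andP[bounds].
  by move=> halted_C /eqP <- Sready; rewrite -[A]mul1r; exact: Sready.
case/andP=> run run_k /kgrun_pmapP[c run_y] Sready cl coin.
apply: (safe_step (G := game) (g := (true_claim C c, init_letter M REnd))) => //.
apply: advances_announce => //; apply: (closed_toss safe_closed) => // _.
apply: IHk run_y _ => // p' C' halted_C'.
by rewrite mulrA -exprSr; exact: Sready.
Qed.

Lemma safe_start fr cl z : kgwon output -> safe (Conf (Start, fr, cl) 0 z).
Proof.
move=> won; apply: (closed_start safe_closed); apply: (closed_pass safe_closed _ halts).
move=> p C x halted_C run_x; have [y run_y win_y] := won x run_x.
apply: (closed_turn safe_closed) => //; apply: safe_pass halts run_y _ => p' C' halted_C'.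
exact: safe_verdict.
Qed.

Lemma protocol_complete : kgwon output -> exists P, halt_prob_ge S protocol w P is_accepting 1.
Proof.
move=> won; have prize_won : 0 < prob_last (spread (prize T)).
  by rewrite prob_last_spread invr_gt0; have := normr_ge0 (prize T); lra.
apply: (safe_verifier blank_msg prize_won _ (safe_start _ _ _ won)).
case=> -[[ph [[[m p] q] y]] [[u a] c]] h z []; rewrite /phase_of /= => -> -> stake; split=> //.
exists Stake, (Accept, (m, p, q, y), (u, a, c)), (Start, (m, p, q, y), (u, a, c)).
by split=> // [|z']; [rewrite stake|exact: safe_start].
Qed.

End Rounds.
End Protocol.

Theorem theorem8 (S : finType) (L : seq S -> Prop) :
  lin_space_reducible L LKG ->
  forall eps : rat, 0 < eps -> eps < 1 / 2 ->
  exists V : verifier S, verifies V L eps /\ perfect_completeness V L.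
Proof.
case=> M [f [computes reduces]] eps eps_gt0 _.
have work_gt0 := linspace_work_gt0 computes.
have perfect : perfect_completeness (protocol M eps) L.
  move=> w /reduces/LKG_kgwon won; have [T halts out_w] := linspace_halting_run w computes.
  by apply: (protocol_complete work_gt0 eps_gt0 halts); rewrite out_w.
exists (protocol M eps); split=> //; split; first exact: wf_protocol; split=> w.
  by case/perfect=> P accepts; exists P; apply: halt_prob_ge_le accepts; rewrite gerBl ltW.
move=> notin_L P; have [T halts out_w] := linspace_halting_run w computes.
apply: (protocol_sound work_gt0 eps_gt0 halts); rewrite out_w.
by move=> /kgwon_LKG/reduces.
Qed.
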